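(* Given $n\ge2$, $\lambda>0$ and $\Lambda>0$, there exists a constant $C=C(n,\lambda,\Lambda)$, depending only on these quantities, such that the following holds. Let $\omega\subset\mathbb R^{n-1}$ be a bounded Lipschitz domain, let $h>0$ and $\Omega=[0,h]\times\omega$. Let $\mathcal L(u)=\sum_{i,j=1}^na_{ij}\frac{\partial^2u}{\partial x_i\partial x_j}$ be an operator with constant real coefficients such that $\sum_{i,j=1}^na_{ij}\xi_i\xi_j\ge\lambda|\xi|^2$ for all $\xi\in\mathbb R^n$ and $\sum_{i=1}^n|a_{ij}|\le\Lambda$ for all $1\le j\le n$. Then every $u\in C^3(\bar\Omega)$ that solves $\mathcal L(u)=0$ and satisfies $u=0$ on $[0,h]\times\partial\omega$ fulfills $$\|\nabla u\|_{L^2(\Omega)}^2\le\frac{C}{h}\|u\|_{L^2(\Omega)}\|u_{x_1}\|_{L^2(\Omega)}+C\|u_{x_1}\|_{L^2(\Omega)}^2 .$$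
   Context: Points of $\mathbb R^n$ are written $x=(x_1,x')$ with $x_1\in\mathbb R$ and $x'=(x_2,\dots,x_n)\in\mathbb R^{n-1}$. Functions are real-valued. *)

(* Defs.v *)
From HB Require Import structures.
From mathcomp Require Import all_boot all_order all_algebra.
From mathcomp Require Import all_classical all_reals all_analysis.

Set Implicit Arguments.
Unset Strict Implicit.
Unset Printing Implicit Defensive.
Import Order.TTheory GRing.Theory Num.Theory.
Import numFieldNormedType.Exports.

Local Open Scope classical_set_scope.
Local Open Scope ring_scope.

Definition measure_rV_display : measure_display. Proof. exact. Qed.

(* The Borel sigma-algebra, presented as the one generated by the coordinates. *)
Section measurable_rV.
Context {R : realType} (n : nat).

Let coors : 'I_n -> 'rV[R]_n -> measurableTypeR R := fun i x => x ord0 i.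

Let rV_set0 : g_sigma_preimage coors set0.
Proof. exact: sigma_algebra0. Qed.

Let rV_setC A : g_sigma_preimage coors A -> g_sigma_preimage coors (~` A).
Proof. exact: sigma_algebraC. Qed.

Let rV_bigcup (F : _^nat) : (forall i, g_sigma_preimage coors (F i)) ->
  g_sigma_preimage coors (\bigcup_i (F i)).
Proof. exact: sigma_algebra_bigcup. Qed.

HB.instance Definition _ := @isMeasurable.Build measure_rV_display
  'rV[R]_n (g_sigma_preimage coors) rV_set0 rV_setC rV_bigcup.

End measurable_rV.

Section measurable_rV_coord.
Context {R : realType}.

Lemma measurable_rV_coord n (i : 'I_n) :
  measurable_fun [set: 'rV[R]_n] (fun x => x ord0 i : measurableTypeR R).
Proof.
move=> _ Y mY; rewrite setTI; apply: sub_sigma_algebra => /=.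
rewrite -bigcup_seq/=; exists i => /=; first by rewrite mem_index_enum.
by exists Y => //; rewrite setTI.
Qed.

Lemma measurable_fun_rVP d (T : measurableType d) n (f : T -> 'rV[R]_n) :
  (forall i, measurable_fun [set: T] (fun t => f t ord0 i : measurableTypeR R)) ->
  measurable_fun [set: T] f.
Proof.
move=> mf.
have prefS : g_sigma_preimage
    (fun i => (fun x : 'rV[R]_n => x ord0 i : measurableTypeR R) \o f)
    `<=` measurable.
  apply: smallest_sub; first exact: sigma_algebra_measurable.
  case: n => [|n] in f mf *; first by rewrite big_ord0.
  rewrite -bigcup_mkord_ord; apply: bigcup_sub => i Ii.
  by move=> A [B mB <-]; exact: mf.
by move: prefS; rewrite g_sigma_preimage_comp => prefS _ A mA;
  apply: prefS; exists A.
Qed.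

Definition rV_cons n (p : measurableTypeR R * 'rV[R]_n) : 'rV[R]_n.+1 :=
  \row_(i < n.+1) oapp (p.2 ord0) p.1 (unlift ord0 i).

Definition rV_uncons n (x : 'rV[R]_n.+1) : measurableTypeR R * 'rV[R]_n :=
  (x ord0 ord0, col' ord0 x).

Lemma rV_consK n : cancel (@rV_cons n) (@rV_uncons n).
Proof.
move=> [t y]; rewrite /rV_uncons mxE unlift_none /=; congr pair.
by apply/rowP => i; rewrite !mxE liftK.
Qed.

Lemma rV_unconsK n : cancel (@rV_uncons n) (@rV_cons n).
Proof.
by move=> x; apply/rowP => i; rewrite mxE; case: unliftP => [j|] -> //=;
  rewrite mxE.
Qed.

Lemma measurable_rV_cons n : measurable_fun [set: _] (@rV_cons n).
Proof.
apply: measurable_fun_rVP => i.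
under eq_fun do rewrite mxE.
case: (unlift ord0 i) => [j|] /=; last exact: measurable_fst.
exact: (measurableT_comp (measurable_rV_coord j) measurable_snd).
Qed.

Lemma measurable_rV_uncons n : measurable_fun [set: _] (@rV_uncons n).
Proof.
apply: measurable_fun_pair; first exact: measurable_rV_coord.
apply: measurable_fun_rVP => i; under eq_fun do rewrite mxE.
exact: measurable_rV_coord.
Qed.

End measurable_rV_coord.

Section lebesgue_rV.
Context {R : realType}.

Section step.
Variables (n : nat) (mu : {sigma_finite_measure set 'rV[R]_n -> \bar R}).

Definition rV_step : set 'rV[R]_n.+1 -> \bar R :=
  pushforward (@lebesgue_measure R \x mu)%E (@rV_cons R n).

Let rV_step0 : rV_step set0 = 0%E.
Proof. by rewrite /rV_step /pushforward preimage_set0 measure0. Qed.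

Let rV_step_ge0 A : (0 <= rV_step A)%E.
Proof. exact: (measure_ge0 (@lebesgue_measure R \x mu)%E). Qed.

Let rV_step_sigma_additive : semi_sigma_additive rV_step.
Proof.
apply: (@measure_semi_sigma_additive _ _ _
  (pushforward (@lebesgue_measure R \x mu)%E (@rV_cons R n))).
exact: measurable_rV_cons.
Qed.

HB.instance Definition _ := isMeasure.Build _ _ _ rV_step
  rV_step0 rV_step_ge0 rV_step_sigma_additive.

Let rV_step_sigma_finite : sigma_finite setT rV_step.
Proof.
have /sigma_finiteP[F [FT ndF Foo]] := sigma_finiteT (@lebesgue_measure R).
have /sigma_finiteP[G [GT ndG Goo]] := sigma_finiteT mu.
exists (fun k => @rV_uncons R n @^-1` (F k `*` G k)).
  rewrite -preimage_bigcup; apply/esym; rewrite -subTset => x _ /=.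
  have [i _ Fi] : (\bigcup_i F i) (rV_uncons x).1 by rewrite -FT.
  have [j _ Gj] : (\bigcup_i G i) (rV_uncons x).2 by rewrite -GT.
  exists (maxn i j) => //; split.
  - by move: Fi; exact/subsetPset/ndF/leq_maxl.
  - by move: Gj; exact/subsetPset/ndG/leq_maxr.
move=> k; have [mF Fk] := Foo k; have [mG Gk] := Goo k; split.
  rewrite -[X in measurable X]setTI; apply: measurable_rV_uncons => //.
  exact: measurableX.
rewrite /rV_step /pushforward -comp_preimage.
rewrite (_ : @rV_uncons R n \o @rV_cons R n = id) ?preimage_id; last first.
  by apply/funext => p /=; rewrite rV_consK.
by rewrite product_measure1E// lte_mul_pinfty// ge0_fin_numE.
Qed.

HB.instance Definition _ :=
  Measure_isSigmaFinite.Build _ _ _ rV_step rV_step_sigma_finite.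

End step.

(* R^0 is a point of mass 1, and R^(n+1) = R * R^n with the product measure. *)
Fixpoint lebesgue_rV (n : nat) : {sigma_finite_measure set 'rV[R]_n -> \bar R} :=
  match n with
  | 0%N => \d_(0 : 'rV[R]_0)
  | m.+1 => rV_step (lebesgue_rV m)
  end.

End lebesgue_rV.

Section domains.
Context {R : realType}.

(* Around each boundary point, w coincides, in suitable Cartesian coordinates
   [x *m Q] (Q orthogonal), with the region above the graph of a Lipschitz
   function of all the coordinates but the i-th. The sup norm of the library
   is equivalent to the Euclidean one, so the notion is the usual one. *)
Definition lipschitz_domain n (w : set 'rV[R]_n) : Prop :=
  [/\ w !=set0, open w, connected w &
    forall x0, (closure w `\` interior w) x0 ->
      exists (Q : 'M[R]_n) (i : 'I_n) (phi : 'rV[R]_n.-1 -> R),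
        [/\ Q *m Q^T = 1%:M, lipschitz phi &
          \forall x \near x0,
            w x <-> phi (col' i (x *m Q)) < (x *m Q) ord0 i]].

Definition coord1 n (hn : (2 <= n)%N) : 'I_n := Ordinal (ltnW hn).

(* [0, h] * w, a point x = (x_1, x') being split as x_1 = x ord0 (coord1 hn)
   and x' = col' (coord1 hn) x. *)
Definition cylinder n (hn : (2 <= n)%N) (h : R) (w : set 'rV[R]_n.-1) :
    set 'rV[R]_n :=
  [set x : 'rV[R]_n | 0 <= x ord0 (coord1 hn) <= h /\ w (col' (coord1 hn) x)].

End domains.

Section derivatives.
Context {R : realType} (n : nat).
Implicit Types (u : 'rV[R]_n -> R) (s : seq 'I_n) (Om : set 'rV[R]_n).

Definition partial (i : 'I_n) u : 'rV[R]_n -> R := 'D_(delta_mx ord0 i) u.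

Definition partials s u : 'rV[R]_n -> R := foldr partial u s.

(* u is C^k in the interior of Om, is continuous on the closure of Om, and its
   partial derivatives up to order k extend continuously to this closure. *)
Definition Ck_closure (k : nat) Om u : Prop :=
  [/\ forall s (i : 'I_n) x, (size s < k)%N -> Om° x ->
        derivable (partials s u) x (delta_mx ord0 i),
      {within closure Om, continuous u} &
      forall s, (size s <= k)%N -> exists g : 'rV[R]_n -> R,
        {within closure Om, continuous g} /\
        (forall x, Om° x -> g x = partials s u x)].

(* Value on the closure of the continuous extension of the i-th partial
   derivative; the library derivative ['D_v u x] at a boundary point would
   depend on the irrelevant values of u outside Om. *)
Definition partial_bar Om (i : 'I_n) u (x : 'rV[R]_n) : R :=
  lim (partial i u y @[y --> within Om° (nbhs x)]).

Definition euclidean_grad Om u (x : 'rV[R]_n) : R :=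
  Num.sqrt (\sum_(i < n) partial_bar Om i u x ^+ 2).

Definition constant_coeff_op (A : 'M[R]_n) u (x : 'rV[R]_n) : R :=
  \sum_(i < n) \sum_(j < n) A i j * partials [:: i; j] u x.

Definition L2norm Om (f : 'rV[R]_n -> R) : \bar R :=
  ('N[lebesgue_rV n]_2%:E [(EFin \o f) \_ Om])%E.

End derivatives.

(* Main.v *)
Require Import Defs.
From HB Require Import structures.
From mathcomp Require Import all_boot all_order all_algebra.
From mathcomp Require Import all_classical all_reals all_analysis.
From mathcomp Require Import measurable_realfun.
From mathcomp Require Import ring lra.
Set Implicit Arguments.
Unset Strict Implicit.
Unset Printing Implicit Defensive.
Import Order.TTheory GRing.Theory Num.Theory.
Import numFieldNormedType.Exports.
Local Open Scope classical_set_scope.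
Local Open Scope ring_scope.

(** Multiplier argument. With [t = x ord0 ord0], the weight [6 t (h - t) / h^2]
    vanishes at both ends of the axis and has mean value 1, so that
    [1 - 6 t (h - t) / h^2] is the derivative of [t (h - t) (h - 2 t) / h^2],
    which vanishes there too. Testing the equation against the first weight
    times [u], and against the second function times the axial derivative of
    [u] (a Rellich identity), writes the energy density [q] as a divergence
    plus terms that contain the axial derivative as a factor. The fluxes vanish
    on the whole boundary: at the ends because of the weights, and on the
    lateral side because [u] and its axial derivative are zero there. The
    divergence theorem is needed one coordinate at a time only, for functions
    bounded by the distance to the boundary along that coordinate, and follows
    from translation invariance and dominated convergence without any
    regularity of the boundary. *)

(** * Lebesgue measure on row vectors *)

Section lebesgue_rV_theory.
Context {R : realType}.
Implicit Types n : nat.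

(** The pushforward under a translation gives every half-open interval its length, and this
    determines Lebesgue measure. *)
Lemma lebesgue_measure_translate (a : R) (A : set (measurableTypeR R)) :
  measurable A ->
  lebesgue_measure ((+%R^~ a) @^-1` A) = lebesgue_measure A.
Proof.
have mf : measurable_fun [set: measurableTypeR R]
    (+%R^~ a : measurableTypeR R -> measurableTypeR R).
  by apply: measurable_funD.
move=> mA; rewrite -[LHS]/(pushforward lebesgue_measure (+%R^~ a) A).
apply/esym/(@lebesgue_measure_unique _
  (pushforward lebesgue_measure (+%R^~ a : _ -> measurableTypeR R))) => //=.
move=> _ [[x y] _ <-] /=; rewrite /pushforward.
rewrite (_ : _ @^-1` _ = `]x - a, y - a]%classic); last first.
  by apply/seteqP; split => z /=; rewrite !in_itv/= ltrBlDr lerBrDr.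
by rewrite !lebesgue_measure_itv/= !lte_fin ltrD2r -!EFinB opprB addrA subrK.
Qed.

Lemma measurable_rV_translate n (v : 'rV[R]_n) :
  measurable_fun setT (fun x : 'rV[R]_n => x + v).
Proof.
apply: measurable_fun_rVP => i; under eq_fun do rewrite mxE.
exact: measurable_funD (measurable_rV_coord i) _.
Qed.

(** Induction on the dimension: through [rV_cons] a translation acts separately on the first
    coordinate and on the others, and a product measure is determined by its values on
    rectangles. *)
Lemma lebesgue_rV_translate n (v : 'rV[R]_n) (A : set 'rV[R]_n) :
  measurable A ->
  lebesgue_rV n ((fun x => x + v) @^-1` A) = lebesgue_rV n A.
Proof.
elim: n v A => [|n IHn] v A mA.
  by rewrite (_ : (fun x => x + v) = id)//; apply/funext => x; rewrite !thinmx0.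
rewrite /= /rV_step /pushforward.
set B := rV_cons (n:=n) @^-1` A.
have mB : measurable B.
  by rewrite -[B]setTI; apply: measurable_rV_cons.
pose T (p : measurableTypeR R * 'rV[R]_n) : measurableTypeR R * 'rV[R]_n :=
  (p.1 + v ord0 ord0, p.2 + col' ord0 v).
have consT p : rV_cons p + v = rV_cons (T p).
  by apply/rowP => i; rewrite !mxE/=; case: unliftP => [j|] ->; rewrite /= ?mxE.
have -> : rV_cons (n:=n) @^-1` ((fun x => x + v) @^-1` A) = T @^-1` B.
  by apply/funext => p; rewrite /preimage/= consT.
have mT : measurable_fun setT T.
  apply: measurable_fun_pair.
    exact: measurable_funD measurable_fst _.
  exact: (measurableT_comp (measurable_rV_translate _) measurable_snd).
transitivity (pushforward (lebesgue_measure \x lebesgue_rV n)%E T B); first by [].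
apply/esym; apply: (@product_measure_unique _ _ _ _ _ _ _
  (pushforward (lebesgue_measure \x lebesgue_rV n)%E T)) => // X Y mX mY.
transitivity ((lebesgue_measure \x lebesgue_rV n)%E
  (((+%R^~ (v ord0 ord0)) @^-1` X) `*` ((fun x => x + col' ord0 v) @^-1` Y))).
  by [].
rewrite product_measure1E.
- by congr (_ * _)%E; [exact: lebesgue_measure_translate|exact: IHn].
- by rewrite -[_ @^-1` _]setTI; apply: measurable_funD.
- by rewrite -[_ @^-1` _]setTI; apply: measurable_rV_translate.
Qed.

Lemma measurable_rV_forall n (B : 'I_n -> set (measurableTypeR R)) :
  (forall i, measurable (B i)) ->
  measurable [set x : 'rV[R]_n | forall i, B i (x ord0 i)].
Proof.
move=> mB; rewrite (_ : [set _ | _] =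
    \bigcap_(i in setT) ((fun x : 'rV[R]_n => x ord0 i) @^-1` B i)).
  apply: fin_bigcap_measurable => // i _.
  by rewrite -[_ @^-1` _]setTI; exact: measurable_rV_coord.
by apply/seteqP; split => x /= xB => [i _|i]; exact: xB.
Qed.

(** The sigma-algebra is generated by the coordinates, so an open set is written as a countable
    union of boxes with rational centre and radius [k.+1%:R^-1]. *)
Lemma open_measurable_rV n (U : set 'rV[R]_n) : open U -> measurable U.
Proof.
move=> oU.
pose box (p : 'rV[rat]_n * nat) : set 'rV[R]_n :=
  [set x | forall i, ball (ratr (p.1 ord0 i) : R) p.2.+1%:R^-1 (x ord0 i)].
rewrite (_ : U = \bigcup_p
    (if pselect (box p `<=` U) then box p else set0)); last first.
  apply/seteqP; split => x; last first.
    by case=> p _; case: pselect => // s; exact: s.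
  move=> Ux; have /nbhs_ballP[e /= e0 eU] := open_nbhs_nbhs (conj oU Ux).
  (* A radius below [e / 2] keeps a box containing [x] inside the ball of radius [e], by the
     triangle inequality through the centre of the box. *)
  have [k ke] : exists k : nat, k.+1%:R^-1 < e / 2.
    have e20 : 0 < e / 2 by rewrite divr_gt0.
    have [k hk] := ltr_add_invr e20.
    by exists k; rewrite -[ltLHS]add0r.
  have k0 : 0 < k.+1%:R^-1 :> R by rewrite invr_gt0.
  have /choice[q hq] i : exists q, ball (ratr q : R) k.+1%:R^-1 (x ord0 i).
    have /rat_in_itvoo[q] : x ord0 i - k.+1%:R^-1 < x ord0 i + k.+1%:R^-1.
      by rewrite ltrD2l gtrN.
    rewrite in_itv/= => /andP[q1 q2]; exists q.
    by rewrite /ball/= ltr_distlC; apply/andP; split;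
      [rewrite ltrBlDr|rewrite -ltrBlDr].
  exists (\row_i q i, k) => //; case: pselect => [s|s] /=.
    by move=> i; rewrite mxE.
  exfalso; apply: s => y yb; apply: eU; split => // i j; rewrite ord1.
  have := hq j; move: (yb j); rewrite /= mxE /ball/= => h1 h2.
  rewrite (le_lt_trans (ler_distD (ratr (q j)) _ _))//.
  rewrite (splitr e) ltrD//; last exact: lt_trans ke.
  by rewrite distrC; exact: lt_trans ke.
apply: countable_bigcupT_measurable => [|p].
  exact: countableP.
case: pselect => s; last exact: measurable0.
apply: (@measurable_rV_forall _ (fun i => ball (ratr (p.1 ord0 i) : R) p.2.+1%:R^-1)).
by move=> i; exact: measurable_ball.
Qed.

Lemma lebesgue_rV_box_fin n (M : R) :
  (lebesgue_rV n [set x : 'rV[R]_n | forall i, (-M < x ord0 i < M)%R] < +oo)%E.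
Proof.
elim: n => [|n IHn].
  by rewrite /= diracE; case: (_ \in _); rewrite ltry.
set A := [set x | _].
have E : @rV_cons R n @^-1` A =
    `]-M, M[%classic `*` [set x : 'rV[R]_n | forall i, -M < x ord0 i < M].
  apply/seteqP; split => -[t y] /=.
    move=> h; split.
      by have := h ord0; rewrite mxE unlift_none/= in_itv.
    by move=> i; have := h (lift ord0 i); rewrite mxE liftK.
  rewrite in_itv/= => -[h1 h2] i; rewrite mxE.
  by case: unlift => [j|]//=; exact: h2.
have -> : lebesgue_rV n.+1 A =
    (lebesgue_measure \x lebesgue_rV n)%E (@rV_cons R n @^-1` A) by [].
rewrite E product_measure1E//.
  apply: lte_mul_pinfty => //; rewrite ge0_fin_numE//.
  apply: (@le_lt_trans _ _ (lebesgue_measure (`]- M, M[%classic : set R))) => //.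
  by rewrite lebesgue_measure_itv/=; case: ifP => _; rewrite ?ltry.
apply: (@measurable_rV_forall _ (fun _ => `]-M, M[%classic)) => i.
exact: measurable_itv.
Qed.

(** The end faces of the cylinder lie in such hyperplanes, so integrals over the closed and the open
    cylinder agree. *)
Lemma lebesgue_rV_hyperplane n (c : R) :
  lebesgue_rV n.+1 [set x : 'rV[R]_n.+1 | x ord0 ord0 = c] = 0%E.
Proof.
set A := [set x | _].
have E : @rV_cons R n @^-1` A = [set c] `*` setT.
  apply/seteqP; split => -[t y] /=; rewrite /A/= mxE unlift_none//=.
  by case.
have -> : lebesgue_rV n.+1 A =
    (lebesgue_measure \x lebesgue_rV n)%E (@rV_cons R n @^-1` A) by [].
rewrite E; transitivity (lebesgue_measure [set c] * lebesgue_rV n setT)%E.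
  exact: product_measure1E.
by rewrite lebesgue_measure_set1 mul0e.
Qed.

Lemma ge0_integral_rV_translate n (v : 'rV[R]_n) (f : 'rV[R]_n -> \bar R) :
  measurable_fun setT f -> (forall x, 0 <= f x)%E ->
  (\int[lebesgue_rV n]_x f (x + v)%R = \int[lebesgue_rV n]_x f x)%E.
Proof.
move=> mf f0.
have mT := measurable_rV_translate v.
rewrite -[LHS](@ge0_integral_pushforward _ _ _ _ _ _ mT _ setT f)//.
apply: eq_measure_integral => A mA _.
exact: lebesgue_rV_translate.
Qed.

Lemma integral_rV_translate n (v : 'rV[R]_n) (f : 'rV[R]_n -> \bar R) :
  measurable_fun setT f ->
  (\int[lebesgue_rV n]_x f (x + v)%R = \int[lebesgue_rV n]_x f x)%E.
Proof.
move=> mf; rewrite integralE [RHS]integralE; congr (_ - _)%E.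
  rewrite -(ge0_integral_rV_translate v (f := f^\+%E)) => //.
    by apply: eq_integral => x _; rewrite !funeposE.
  exact: measurable_funepos.
rewrite -(ge0_integral_rV_translate v (f := f^\-%E)) => //.
  by apply: eq_integral => x _; rewrite !funenegE.
exact: measurable_funeneg.
Qed.

End lebesgue_rV_theory.

(** * Mean value theorem along lines *)

Section lines.
Context {R : realType} {V : normedModType R}.
Implicit Types (F : V -> R) (x v : V) (D : set V).

Lemma is_derive_line F x v (t d : R) :
  is_derive (x + t *: v) v F d -> is_derive t 1 (fun s => F (x + s *: v)) d.
Proof.
have E : (fun h : R => h^-1 *: (((fun s => F (x + s *: v)) \o shift t) (h *: 1) -
    F (x + t *: v))) =
    (fun h : R => h^-1 *: ((F \o shift (x + t *: v)) (h *: v) - F (x + t *: v))).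
  apply/funext => h /=; congr (_ *: (F _ - _)).
  by rewrite scalerDl addrCA -[h *: 1]/(h * 1) mulr1.
by move=> [dF <-]; split; [rewrite /derivable E|rewrite /derive E].
Qed.

(** The segment is parametrised by the unit interval, so that [s] may have either sign. *)
Lemma mean_value_line F (G : V -> R) x v (s : R) :
  (forall r : R, 0 <= r <= 1 -> is_derive (x + (r * s) *: v) v F (G (x + (r * s) *: v))) ->
  exists2 r, 0 < r < 1 & F (x + s *: v) - F x = s * G (x + (r * s) *: v).
Proof.
move=> dF.
have dl (r : R) : 0 <= r <= 1 ->
    is_derive r 1 (fun r => F (x + (r * s) *: v)) (s * G (x + (r * s) *: v)).
  move=> r1; pose f t := F (x + t *: v); pose g (t : R) := t * s.
  have df : is_derive (g r) 1 f (G (x + (r * s) *: v)) by apply/is_derive_line/dF.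
  have dg : is_derive r 1 g s.
    have : is_derive r (1 : R) ((id : R -> R) * cst s) (r *: 0 + s *: 1).
      exact: is_deriveM.
    by rewrite scaler0 add0r -[s *: 1]/(s * 1) mulr1.
  have := @is_derive1_comp R f g r _ _ df dg.
  by rewrite mulrC.
have [||r rs E] := @MVT R (fun r => F (x + (r * s) *: v))
    (fun r => s * G (x + (r * s) *: v)) 0 1 ltr01.
- by move=> r; rewrite in_itv/= => /andP[/ltW r0 /ltW r1]; apply: dl; rewrite r0.
- apply: derivable_within_continuous => r; rewrite in_itv/= => rs.
  exact: (@ex_derive _ _ _ _ _ _ _ (dl r rs)).
exists r; first by move: rs; rewrite in_itv.
by move: E; rewrite mul0r mul1r scale0r addr0 subr0 mulr1.
Qed.

End lines.

(** * Vanishing integral of a directional derivative *)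

Lemma bounded_integrable d (T : measurableType d) (R : realType)
    (mu : {measure set T -> \bar R}) (D : set T) (H : T -> R) (K : R) :
  measurable D -> (mu D < +oo)%E -> measurable_fun D H ->
  (forall x, D x -> `|H x| <= K) -> mu.-integrable D (EFin \o H).
Proof.
move=> mD finD mH bH; apply: measurable_bounded_integrable => //.
exists K; split; first exact: num_real.
by move=> r Kr x Dx; exact: le_trans (bH _ Dx) (ltW Kr).
Qed.

Section divergence.
Context {R : realType} (n : nat).
Variables (D : set 'rV[R]_n) (v : 'rV[R]_n) (F G : 'rV[R]_n -> R) (M : R).
Hypotheses (oD : open D) (finD : (lebesgue_rV n D < +oo)%E).
Hypotheses (mF : measurable_fun D F) (mG : measurable_fun D G).
Hypotheses (bF : forall x, D x -> `|F x| <= M) (bG : forall x, D x -> `|G x| <= M).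
Hypothesis dF : forall x, D x -> is_derive x v F (G x).
Hypothesis exitF :
  forall x s, D x -> ~ D (x + s *: v) -> `|F x| <= M * `|s|.

(* The second term is cut off at [x - s *: v] instead of at [x]: both terms then
   have the same integral over D by translation invariance, and nothing has to
   be known about the measure of the boundary of D. *)
Let quot (s : R) x := s^-1 * ((F \_ D) (x + s *: v) - F x * \1_D (x - s *: v)).

(** This bound is uniform in [s] and serves as domination. If a shifted point or part of the segment
    is outside [D], the exit hypothesis makes the remaining values of order [s]; otherwise the mean
    value theorem applies. *)
Let quot_le s x : 0 < s -> D x -> `|quot s x| <= 2 * M.
Proof.
move=> s0 Dx; rewrite /quot normrM gtr0_norm ?invr_gt0// ler_pdivrMl//.
have M0 : 0 <= M by exact: le_trans (bF Dx).
rewrite /patch indicE; case: ifPn => [|/negP] Dp; last first.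
  rewrite sub0r normrN normrM (le_trans (_ : _ <= `|F x|))//.
    by rewrite ler_piMr// ger0_norm// lern1 leq_b1.
  rewrite (le_trans (exitF (s := s) Dx _))//.
    by move=> h; apply: Dp; rewrite inE.
  by rewrite gtr0_norm// mulrC ler_pM2l// ler_peMl// ler1n.
rewrite inE in Dp.
case: (boolP (_ \in _)) => [|/negP] Dm; last first.
  rewrite mulr0 subr0 (le_trans (exitF (s := - (2 * s)) Dp _))//.
    move=> h; apply: Dm; rewrite inE; move: h.
    by rewrite scaleNr mulrDl mul1r scalerDl opprD addrA addrK.
  rewrite normrN gtr0_norm ?mulr_gt0//.
  by have -> : M * (2 * s) = s * (2 * M) by ring.
rewrite mulr1.
have [inD|/existsNP[r /not_implyP[/andP[r0 r1] nD]]] :=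
    pselect (forall r : R, 0 <= r <= 1 -> D (x + (r * s) *: v)).
  have [r r1|r /andP[r0 r1] ->] := @mean_value_line _ _ F G x v s.
    exact/dF/inD.
  rewrite normrM gtr0_norm// ler_pM2l//.
  apply: le_trans (bG (inD r _)) _; first by rewrite !ltW.
  by rewrite ler_peMl// ler1n.
(* The segment meets the complement of [D] at parameter [r * s]; [exitF] from the two endpoints
   bounds the values there by [M * (r * s)] and [M * (s - r * s)]. *)
have rs : 0 <= r * s <= s by rewrite mulr_ge0//= ?ler_piMl// ltW.
rewrite (le_trans (ler_normB _ _))// mulrA (mulrC s) -mulrA mulrDl mul1r.
move/andP: rs => [rs0 rs1]; rewrite lerD//.
  rewrite (le_trans (exitF (s := r * s - s) Dp _))//.
    by rewrite -addrA -scalerDl [s + _]addrC subrK.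
  by rewrite mulrC ler_wpM2r// distrC ger0_norm ?subr_ge0// lerBlDr lerDl.
rewrite (le_trans (exitF (s := r * s) Dx nD))//.
by rewrite mulrC ler_wpM2r// ger0_norm.
Qed.

Let mD : measurable D. Proof. exact: open_measurable_rV. Qed.

Let mFD : measurable_fun setT (F \_ D).
Proof. by apply/(measurable_restrictT _ _).1. Qed.

Let mquot s : measurable_fun D (quot s).
Proof.
apply: measurable_funM; first exact: measurable_cst.
apply: measurable_funB.
  apply: (@measurable_funS _ _ _ _ setT) => //.
  exact: measurableT_comp mFD (measurable_rV_translate _).
apply: measurable_funM => //.
apply: (@measurable_funS _ _ _ _ setT) => //.
have m1 : measurable_fun setT (\1_D : 'rV[R]_n -> R) by exact: measurable_indic.
exact: (measurableT_comp m1 (measurable_rV_translate (- (s *: v)))).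
Qed.

(** On [D] the quotient is [s^-1 * (f (x + s *: v) - f x)], with [f] as posed below. Both [f] and
    its translate vanish outside [D], so the two integrals extend to the whole space, where they
    cancel by translation invariance. *)
Let integral_quot s : 0 < s -> (\int[lebesgue_rV n]_(x in D) (quot s x)%:E = 0)%E.
Proof.
move=> s0.
pose f x := (F \_ D) x * \1_D (x - s *: v).
have mf : measurable_fun setT f.
  apply: measurable_funM => //.
  have m1 : measurable_fun setT (\1_D : 'rV[R]_n -> R) by exact: measurable_indic.
  exact: (measurableT_comp m1 (measurable_rV_translate (- (s *: v)))).
have bf x : D x -> `|f x| <= M.
  move=> Dx; rewrite /f /patch mem_set// normrM (le_trans _ (bF Dx))//.
  by rewrite ler_piMr// ger0_norm indicE// lern1 leq_b1.
have M0 x : D x -> 0 <= M by move=> Dx; exact: le_trans (bF Dx).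
have mf' : measurable_fun setT (fun x : 'rV[R]_n => f (x + s *: v)).
  exact: (measurableT_comp mf (measurable_rV_translate _)).
have bf' x : D x -> `|f (x + s *: v)| <= M.
  move=> Dx; rewrite /f /patch; case: ifPn => [/set_mem Dxs|_].
    by rewrite addrK indicE mem_set// mulr1 bF.
  by rewrite mul0r normr0 (M0 _ Dx).
have i1 := bounded_integrable mD finD (measurable_funTS mf) bf.
have i2 := bounded_integrable mD finD (measurable_funTS mf') bf'.
have -> : (\int[lebesgue_rV n]_(x in D) (quot s x)%:E =
    \int[lebesgue_rV n]_(x in D) (s^-1%:E * ((f (x + s *: v))%:E - (f x)%:E)))%E.
  apply: eq_integral => x; rewrite inE => Dx.
  rewrite -EFinB -EFinM; congr EFin; rewrite /quot /f addrK.
  by rewrite [X in _ * (_ * X - _)]indicE mem_set// mulr1 [X in _ = _ * (_ - X * _)]patchE mem_set.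
rewrite integralZl//; last exact: integrableB.
rewrite integralB//.
have -> : (\int[lebesgue_rV n]_(x in D) (f x)%:E = \int[lebesgue_rV n]_x (f x)%:E)%E.
  rewrite integral_mkcond; apply: eq_integral => x _.
  rewrite patchE; case: ifPn => // xD.
  by rewrite /f patchE (negbTE xD) mul0r.
have -> : (\int[lebesgue_rV n]_(x in D) (f (x + s *: v))%:E =
    \int[lebesgue_rV n]_x (f (x + s *: v)%R)%:E)%E.
  rewrite integral_mkcond; apply: eq_integral => x _.
  rewrite patchE; case: ifPn => // xD.
  by rewrite /f addrK indicE (negbTE xD) mulr0.
rewrite (@integral_rV_translate _ _ (s *: v) (EFin \o f)); last exact/measurable_EFinP.
suff : (\int[lebesgue_rV n]_x (f x)%:E)%E \is a fin_num.
  by move=> /subee ->; rewrite mule0.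
rewrite (_ : (\int[lebesgue_rV n]_x (f x)%:E = \int[lebesgue_rV n]_(x in D) (f x)%:E)%E).
  exact: integrable_fin_num.
rewrite [RHS]integral_mkcond; apply: eq_integral => x _.
rewrite patchE; case: ifPn => // xD.
by rewrite /f patchE (negbTE xD) mul0r.
Qed.

Let quot_cvg x : D x -> quot k.+1%:R^-1 x @[k --> \oo] --> G x.
Proof.
move=> Dx.
have h0 := @cvg_harmonic R.
have s_cvg : (k.+1%:R^-1 : R) @[k --> \oo] --> (0 : R)^'.
  move=> U U0.
  have : \forall k \near \oo, harmonic k != 0 :> R -> U (harmonic k) := h0 _ U0.
  move=> near_U; apply: filterS near_U => k; apply.
  by rewrite /harmonic/= invr_eq0 pnatr_eq0.
have dq : h^-1 *: ((F \o shift x) (h *: v) - F x) @[h --> 0^'] --> G x.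
  by have [dFx <-] := dF Dx; exact: dFx.
(* As [D] is open, the cut-offs disappear for large [k] and the ordinary difference quotient
   remains. *)
have nD (w : 'rV[R]_n) : \forall k \near \oo, D (x + k.+1%:R^-1 *: w).
  have : x + (k.+1%:R^-1 : R) *: w @[k --> \oo] --> x + 0 *: w.
    by apply: cvgD; [exact: cvg_cst|apply: cvgZ; [exact: h0|exact: cvg_cst]].
  by rewrite scale0r addr0; apply; exact: open_nbhs_nbhs.
apply: cvg_trans (cvg_comp _ _ s_cvg dq).
apply: near_eq_cvg; near=> k => /=.
rewrite /quot patchE mem_set; last by near: k; exact: nD.
rewrite indicE mem_set ?mulr1; last by rewrite -scalerN; near: k; exact: nD.
by congr (_ * (F _ - _)); rewrite addrC.
Unshelve. all: by end_near. Qed.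

(** The truncated quotients have integral 0, converge to [G] on [D], and are dominated by the
    constant [2 * M], integrable on a set of finite measure. *)
Lemma integral_directional_derivative_eq0 :
  (\int[lebesgue_rV n]_(x in D) (G x)%:E = 0)%E.
Proof.
have [|||||_ _ cvgI] := @dominated_convergence _ _ _ (lebesgue_rV n) D mD
  (fun k => EFin \o quot k.+1%:R^-1) (EFin \o G) (EFin \o cst (2 * M)).
- by move=> k; apply/measurable_EFinP.
- exact/measurable_EFinP.
- apply: aeW => x Dx; apply: cvg_EFin; last exact: quot_cvg.
  by near=> k.
- have [-> | /set0P[x Dx]] := eqVneq D set0.
    by apply: (@bounded_integrable _ _ _ _ _ _ `|2 * M|) => //; rewrite measure0 ltry.
  exact: (@bounded_integrable _ _ _ _ _ _ `|2 * M|).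
- apply: aeW => x k Dx /=; rewrite lee_fin; apply: quot_le Dx.
  by rewrite invr_gt0.
have E : [sequence (\int[lebesgue_rV n]_(x in D) (EFin \o quot k.+1%:R^-1) x)%E]_k
    = cst 0%E.
  by apply/funext => k /=; rewrite integral_quot// invr_gt0.
rewrite E in cvgI.
by apply/esym; apply: (cvg_unique _ (cvg_cst _) cvgI); exact: ereal_hausdorff.
Unshelve. all: by end_near. Qed.

End divergence.

(** * Exit from an open set along a line *)

Section exit.
Context {R : realType} {V : normedModType R}.
Implicit Types (D : set V) (F G : V -> R) (v x : V).

(** The parameter is the infimum of the [r >= 0] at which the line is outside [D]. Openness puts the
    point at this infimum outside [D], and the infimum is then nonzero because [x] is in [D]. *)
Lemma first_exit D v x (s : R) : open D -> D x -> ~ D (x + s *: v) ->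
  exists r : R, [/\ 0 < r <= 1, ~ D (x + (r * s) *: v) &
    forall t, 0 <= t < r -> D (x + (t * s) *: v)].
Proof.
move=> oD Dx nDs; pose g (r : R) : V := x + (r * s) *: v.
have cg : continuous g.
  move=> r; apply: cvgD; first exact: cvg_cst.
  by apply: cvgZr_tmp; apply: cvgMr_tmp; exact: cvg_id.
pose E : set R := [set r | 0 <= r /\ ~ D (g r)].
have E1 : E 1 by split=> //; rewrite /g mul1r.
have infE : has_inf E by split; [exists 1|exists 0 => r []].
have E0 : lbound E 0 by move=> r [].
have r0 : 0 <= inf E by apply: lb_le_inf => //; exists 1.
have below t : 0 <= t < inf E -> D (g t).
  move=> /andP[t0 tE]; apply: contrapT => nD.
  by move: tE; rewrite ltNge => /negP; apply; apply: ge_inf => //; exists 0.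
have nDr : ~ D (g (inf E)).
  move=> Dr; have /nbhs_ballP[e /= e0 he] : nbhs (inf E) (g @^-1` D).
    by apply: cg; exact: open_nbhs_nbhs.
  have [r [r0' nD] rE] := inf_adherent e0 infE.
  have Er : inf E <= r by apply: ge_inf; [exists 0|split].
  apply: nD; apply: he; rewrite /ball/= ltr_distlC rE.
  by rewrite (lt_le_trans _ Er)// ltrBlDr ltrDl.
exists (inf E); split => //; rewrite ge_inf// ?andbT; last by exists 0.
rewrite lt_neqAle r0 andbT; apply/eqP => E00; apply: nDr.
by rewrite -E00 /g mul0r scale0r addr0.
Qed.

(** Smallness of [F] is asked only at points of [D] before the first exit, so that the lemma applies
    to derivatives of [u], which are controlled only inside [D]. The mean value theorem carries the
    bound back to [x]. *)
Lemma norm_le_exit D v F G (M : R) x (s : R) : open D ->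
  (forall y, D y -> is_derive y v F (G y)) -> (forall y, D y -> `|G y| <= M) ->
  D x -> ~ D (x + s *: v) ->
  (forall r, 0 < r <= 1 -> ~ D (x + (r * s) *: v) ->
    (forall t, 0 <= t < r -> D (x + (t * s) *: v)) ->
    forall e, 0 < e -> exists2 t, 0 <= t < r & `|F (x + (t * s) *: v)| <= e) ->
  `|F x| <= M * `|s|.
Proof.
move=> oD dF bG Dx nDs lim0; have M0 : 0 <= M := le_trans (normr_ge0 _) (bG _ Dx).
have [r [r01 nD Dr]] := first_exit oD Dx nDs.
apply/ler_addgt0Pr => e e0; have [t /andP[t0 tr] Ft] := lim0 r r01 nD Dr e e0.
have [q /andP[q0 q1]|q /andP[q0 q1] E] := @mean_value_line _ _ F G x v (t * s).
  by apply: dF; rewrite mulrA; apply: Dr; rewrite mulr_ge0//= (le_lt_trans _ tr)// ler_piMl.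
have bq : `|G (x + (q * (t * s)) *: v)| <= M.
  rewrite mulrA; apply/bG/Dr; rewrite mulr_ge0 ?(ltW q0)//=.
  by rewrite (le_lt_trans _ tr)// ler_piMl// ltW.
have -> : F x = F (x + (t * s) *: v) - (t * s) * G (x + (q * (t * s)) *: v).
  by rewrite -E opprB addrCA subrr addr0.
rewrite (le_trans (ler_normB _ _))// addrC lerD// !normrM (ger0_norm t0).
rewrite mulrC ler_pM// ?mulr_ge0// ler_piMl//.
by rewrite (le_trans (ltW tr))//; case/andP: r01.
Qed.

(** A quantitative form of zero boundary values along [v]: [F] is at most a constant times the
    parameter distance to any exit point of the line, on either side. *)
Definition vanishing D v F := exists M : R, forall x (s : R),
  D x -> ~ D (x + s *: v) -> `|F x| <= M * `|s|.

Definition bounded_on D F := exists M : R, forall x, D x -> `|F x| <= M.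

Lemma vanishingD D v F G : vanishing D v F -> vanishing D v G ->
  vanishing D v (fun x => F x + G x).
Proof.
move=> [M hM] [N hN]; exists (M + N) => x s Dx nD.
by rewrite (le_trans (ler_normD _ _))// mulrDl lerD ?hM ?hN.
Qed.

Lemma vanishingM D v F G : vanishing D v F -> bounded_on D G ->
  vanishing D v (fun x => F x * G x).
Proof.
move=> [M hM] [N hN]; exists (M * N) => x s Dx nD.
by rewrite normrM mulrAC ler_pM ?hM ?hN.
Qed.

Lemma bounded_onD D F G : bounded_on D F -> bounded_on D G ->
  bounded_on D (fun x => F x + G x).
Proof.
move=> [M hM] [N hN]; exists (M + N) => x Dx.
by rewrite (le_trans (ler_normD _ _))// lerD ?hM ?hN.
Qed.

Lemma bounded_onM D F G : bounded_on D F -> bounded_on D G ->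
  bounded_on D (fun x => F x * G x).
Proof.
move=> [M hM] [N hN]; exists (M * N) => x Dx.
by rewrite normrM ler_pM ?hM ?hN.
Qed.

Lemma bounded_on_cst D (c : R) : bounded_on D (fun=> c).
Proof. by exists `|c|. Qed.

Lemma bounded_on_sum D (I : Type) (r : seq I) (F : I -> V -> R) :
  (forall i, bounded_on D (F i)) -> bounded_on D (fun x => \sum_(i <- r) F i x).
Proof.
move=> bF; elim: r => [|i r IHr].
  by under eq_fun do rewrite big_nil; exact: bounded_on_cst.
by under eq_fun do rewrite big_cons; exact: bounded_onD.
Qed.

End exit.

(** * Continuity, measurability and bounds in coordinates *)

Section continuity.
Context {R : realType}.

Lemma open_continuous_measurable_rV n (D : set 'rV[R]_n) (f : 'rV[R]_n -> R) :
  open D -> (forall x, D x -> {for x, continuous f}) -> measurable_fun D f.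
Proof.
move=> oD cf; apply: (measurability _ (RGenOpens.measurableE R)) => //.
move=> _ [_ [a [b ->] <-]]; apply: open_measurable_rV.
rewrite openE => x [Dx fx]; apply: filterI; first exact: open_nbhs_nbhs.
by apply: (cf x Dx); apply: open_nbhs_nbhs; split => //; exact: itv_open.
Qed.

Lemma bounded_set_coord n (w : set 'rV[R]_n) : bounded_set w ->
  exists2 K : R, 0 < K & forall y, w y -> forall j, `|y ord0 j| < K.
Proof.
case=> K' [_ wK']; pose K := `|K'| + 1.
have wK y : w y -> `|y| <= K by apply: wK'; rewrite (le_lt_trans (ler_norm _))// ltrDl.
exists (`|K| + 1) => [|y wy j]; first by rewrite ltr_wpDl.
have : ball (0 : 'rV[R]_n) (`|K| + 1) y.
  rewrite mx_norm_ball /ball_/= sub0r normrN.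
  by rewrite (le_lt_trans (wK _ wy))// (le_lt_trans (ler_norm _))// ltrDl.
by move=> [_ /(_ ord0 j)]; rewrite mxE /ball/= sub0r normrN.
Qed.

Lemma bounded_rV_finite n (D : set 'rV[R]_n) (K : R) : measurable D ->
  (forall x, D x -> forall j, `|x ord0 j| < K) -> (lebesgue_rV n D < +oo)%E.
Proof.
move=> mD DK; apply: le_lt_trans (lebesgue_rV_box_fin n K).
apply: le_measure; rewrite ?inE//.
  apply: (@measurable_rV_forall _ _ (fun _ => `]-K, K[%classic)) => i.
  exact: measurable_itv.
by move=> x Dx i; have := DK x Dx i; rewrite ltr_norml.
Qed.

Lemma coord_bounded_compact n (D : set 'rV[R]_n) (K : R) : closed D ->
  (forall x, D x -> forall j, `|x ord0 j| <= K) -> compact D.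
Proof.
move=> cD DK; apply: bounded_closed_compact => //.
exists `|K|; split; first exact: num_real.
move=> r Kr x Dx; have r0 : 0 < r := le_lt_trans (normr_ge0 _) Kr.
have : ball (0 : 'rV[R]_n) r x.
  split=> // i j; rewrite mxE ord1 /ball/= sub0r normrN.
  by rewrite (le_lt_trans (DK x Dx j))// (le_lt_trans (ler_norm _)).
by rewrite mx_norm_ball /ball_/= sub0r normrN => /ltW.
Qed.

Lemma closure_coord_le n (D : set 'rV[R]_n) (K : R) :
  (forall x, D x -> forall j, `|x ord0 j| <= K) ->
  forall x, closure D x -> forall j, `|x ord0 j| <= K.
Proof.
move=> DK x Dx j; apply/ler_addgt0Pr => e e0.
have [y [Dy [_ /(_ ord0 j)]]] : D `&` ball x e !=set0.
  by apply: Dx; exact: nbhsx_ballx.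
rewrite /ball/= => xy.
rewrite -[x ord0 j](subrK (y ord0 j)) (le_trans (ler_normD _ _))// addrC.
by rewrite lerD ?DK// ltW.
Qed.

Lemma within_continuous_near (V : normedModType R) (B : set V) (f : V -> R) (y : V) (e : R) :
  {within B, continuous f} -> B y -> 0 < e ->
  exists2 d : R, 0 < d & forall z, B z -> `|y - z| < d -> `|f y - f z| < e.
Proof.
move=> /subspace_continuousP cf By e0.
have /cvgrPdist_lt /(_ e e0) := cf y By.
rewrite /within/= => /nbhs_ballP[d d0 hd].
by exists d => // z Bz yz; apply: hd => //; rewrite -ball_normE.
Qed.

End continuity.

(** * Functions of class C^k up to the boundary *)

Section Ck_closure_theory.
Context {R : realType} (n : nat) (Om : set 'rV[R]_n) (u : 'rV[R]_n -> R) (k : nat).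
Hypothesis Cu : Ck_closure k Om u.
Let D := Om°.

Lemma Ck_closure_is_derive s (i : 'I_n) x : (size s < k)%N -> D x ->
  is_derive x (delta_mx ord0 i) (partials s u) (partials (i :: s) u x).
Proof. by case: Cu => dC _ _ sk Dx; split => //; exact: dC. Qed.

(** Near an interior point the derivative coincides with its extension and inherits its
    continuity. *)
Lemma Ck_closure_continuous s x : (size s <= k)%N -> D x ->
  {for x, continuous (partials s u)}.
Proof.
case: Cu => _ _ eC sk Dx; have [g [/subspace_continuousP cg gu]] := eC s sk.
have nD : nbhs x D by apply: nbhs_interior; exact: Dx.
have cx : closure Om x by apply: subset_closure; exact: interior_subset.
have := cg x cx; rewrite /prop_for/continuous_at -gu// => gx.
move=> U nU; have {}nU : \forall z \near x, closure Om z -> U (g z) := gx U nU.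
have : \forall z \near x, U (partials s u z).
  apply: filterS2 nD nU => z Dz; rewrite gu//; apply.
  by apply: subset_closure; exact: interior_subset.
by [].
Qed.

(** The extension is continuous on the closure of [Om], which is compact. *)
Lemma Ck_closure_bounded s K : (size s <= k)%N ->
  (forall x, Om x -> forall j, `|x ord0 j| <= K) -> bounded_on D (partials s u).
Proof.
case: Cu => _ _ eC sk OmK; have [g [cg gu]] := eC s sk.
have cptOm : compact (closure Om).
  apply: (@coord_bounded_compact _ _ _ K); first exact: closed_closure.
  exact: closure_coord_le.
have /compact_bounded[M [_ hM]] := continuous_compact cg cptOm.
exists (`|M| + 1) => x Dx; rewrite -gu//; apply: (hM (`|M| + 1)).
  by rewrite (le_lt_trans (ler_norm _))// ltrDl.
exists x => //.
by apply: subset_closure; exact: interior_subset.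
Qed.

Lemma partial_bar_interior i x : (0 < k)%N -> D x -> partial_bar Om i u x = partial i u x.
Proof.
move=> k0 Dx; have PF : ProperFilter (within Om° (nbhs x)).
  by apply: within_nbhs_proper; exact: subset_closure.
have cx : partial i u y @[y --> x] --> partial i u x.
  exact: (@Ck_closure_continuous [:: i]).
apply: cvg_lim => //; apply: cvg_trans cx.
by apply: cvg_app; exact: cvg_within.
Qed.

End Ck_closure_theory.

(** * Geometry of the cylinder *)

Section cylinder.
Context {R : realType} (m : nat).
Implicit Types (w : set 'rV[R]_m) (x : 'rV[R]_m.+1) (h s : R) (i : 'I_m.+1).

Definition open_cylinder h w : set 'rV[R]_m.+1 :=
  [set x : 'rV[R]_m.+1 | 0 < x ord0 ord0 < h /\ w (col' ord0 x)].

Lemma cylinderE (hn : (2 <= m.+1)%N) h w : cylinder hn h w =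
  [set x : 'rV[R]_m.+1 | 0 <= x ord0 ord0 <= h /\ w (col' ord0 x)].
Proof. by rewrite /cylinder (_ : coord1 hn = ord0)//; exact: val_inj. Qed.

Lemma continuous_col' : continuous (fun x : 'rV[R]_m.+1 => col' ord0 x : 'rV[R]_m).
Proof.
move=> x U /nbhs_ballP[e /= e0 eU]; apply/nbhs_ballP; exists e => //= y [_ xy].
by apply: eU; split => // i j; rewrite !mxE; exact: xy.
Qed.

Lemma open_open_cylinder h w : open w -> open (open_cylinder h w).
Proof.
move=> ow; rewrite (_ : open_cylinder h w =
  (fun x : 'rV[R]_m.+1 => x ord0 ord0) @^-1` (`]0, h[%classic : set R) `&` (fun x : 'rV[R]_m.+1 => col' ord0 x) @^-1` w).
  apply: openI; apply: open_comp => //.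
  - by move=> x _; exact: coord_continuous.
  - by move=> x _; exact: continuous_col'.
by apply/seteqP; split => x /=; rewrite in_itv.
Qed.

Lemma line_coord0 x i s : i != ord0 -> (x + s *: delta_mx ord0 i) ord0 ord0 = x ord0 ord0.
Proof. by move=> i0; rewrite !mxE eqxx eq_sym (negbTE i0)/= mulr0 addr0. Qed.

Lemma line0_coord0 x s : (x + s *: delta_mx ord0 ord0) ord0 ord0 = x ord0 ord0 + s.
Proof. by rewrite !mxE !eqxx/= mulr1. Qed.

Lemma line0_col' x s : col' ord0 (x + s *: delta_mx ord0 ord0) = col' ord0 x.
Proof. by apply/rowP => j; rewrite !mxE eqxx/= mulr0 addr0. Qed.

(** Around an interior point, axial shifts by [e / 2] both ways stay in the cylinder, which makes
    the inequalities at the two ends strict. *)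
Lemma interior_cylinder (hn : (2 <= m.+1)%N) h w : open w ->
  (cylinder hn h w)° = open_cylinder h w.
Proof.
move=> ow; rewrite cylinderE; apply/seteqP; split => x; last first.
  move=> Dx; have : nbhs x (open_cylinder h w).
    by apply: open_nbhs_nbhs; split => //; exact: open_open_cylinder.
  apply: filterS.
  by move=> y [/andP[y0 yh] wy]; split => //; rewrite !ltW.
move=> nx; have [_ wx] := interior_subset nx; split => //.
have [e /= e0 he] : nbhs_ball x [set x : 'rV[R]_m.+1 | 0 <= x ord0 ord0 <= h /\ w (col' ord0 x)].
  exact/nbhs_ballP.
have B (s : R) : `|s| < e -> 0 <= x ord0 ord0 + s <= h.
  move=> se; rewrite -line0_coord0.
  suff /he[] : ball x e (x + s *: delta_mx ord0 ord0) by [].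
  split=> // i j; rewrite /ball/= !mxE opprD addrA subrr sub0r normrN normrM.
  by rewrite (le_lt_trans _ se)// ler_piMr//; case: (_ && _); rewrite ?normr1 ?normr0.
have e2 : 0 < e / 2 by rewrite divr_gt0.
have ee : e / 2 < e by rewrite ltr_pdivrMr// ltr_pMr// ltr1n.
have /andP[h1 _] : 0 <= x ord0 ord0 - e / 2 <= h by apply: B; rewrite normrN gtr0_norm.
have /andP[_ h2] : 0 <= x ord0 ord0 + e / 2 <= h by apply: B; rewrite gtr0_norm.
apply/andP; split.
  by rewrite (lt_le_trans e2)// -subr_ge0.
by rewrite (lt_le_trans _ h2)// ltrDl.
Qed.

Lemma cylinder_coord_bounded (hn : (2 <= m.+1)%N) h w : bounded_set w ->
  exists K : R, forall x, cylinder hn h w x -> forall j, `|x ord0 j| < K.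
Proof.
move=> /bounded_set_coord[K K0 wK]; exists (K + (`|h| + 1)) => x; rewrite cylinderE.
move=> [/andP[x0 xh] wx] j; case: (unliftP ord0 j) => [k ->|->].
  by have := wK _ wx k; rewrite mxE => /lt_le_trans; apply; rewrite lerDl addr_ge0.
rewrite ger0_norm// (le_lt_trans xh)// (le_lt_trans (ler_norm _))//.
by rewrite addrC -addrA ltrDl addr_gt0.
Qed.

Lemma measurable_cylinder (hn : (2 <= m.+1)%N) h w : open w ->
  measurable (cylinder hn h w).
Proof.
move=> ow; rewrite cylinderE (_ : [set _ | _] =
  (fun x : 'rV[R]_m.+1 => x ord0 ord0) @^-1` (`[0, h]%classic : set R) `&` (fun x : 'rV[R]_m.+1 => col' ord0 x) @^-1` w).
  apply: measurableI.
    rewrite -[_ @^-1` _]setTI; apply: measurable_rV_coord => //.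
  apply: open_measurable_rV; apply: open_comp => // x _; exact: continuous_col'.
by apply/seteqP; split => x /=; rewrite in_itv.
Qed.

Lemma cylinder_boundary_null (hn : (2 <= m.+1)%N) h w :
  exists N : set 'rV[R]_m.+1, [/\ measurable N, lebesgue_rV m.+1 N = 0%E &
    cylinder hn h w `\` N = open_cylinder h w].
Proof.
pose H c : set 'rV[R]_m.+1 := [set x : 'rV[R]_m.+1 | x ord0 ord0 = c].
have mH c : measurable (H c).
  rewrite (_ : H c = (fun x : 'rV[R]_m.+1 => x ord0 ord0) @^-1` [set c])//.
  by rewrite -[_ @^-1` _]setTI; exact: measurable_rV_coord.
exists (H 0 `|` H h); split.
- exact: measurableU.
- have H0 c : lebesgue_rV m.+1 (H c) = 0%E by exact: lebesgue_rV_hyperplane.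
  exact: etrans (measureU0 (mH 0) (mH h) (H0 h)) (H0 0).
rewrite cylinderE; apply/seteqP; split => x /=.
  move=> [[/andP[x0 xh] wx] /not_orP[n0 nh]]; split=> //.
  by rewrite !lt_neqAle x0 xh !andbT; apply/andP; split; apply/eqP => // /esym.
move=> [/andP[x0 xh] wx]; split; first by rewrite !ltW.
by move=> [] E; move: x0 xh; rewrite /H/= in E *; rewrite E ltxx.
Qed.

End cylinder.

(** * Decay of [u] and of its axial derivative at the lateral boundary *)

Lemma near_below {R : realFieldType} (r A e : R) : 0 < r -> 0 <= A -> 0 < e ->
  exists2 t, 0 <= t < r & (r - t) * A < e.
Proof.
move=> r0 A0 e0; have A1 : 0 < A + 1 by rewrite ltr_wpDl.
pose d := Num.min r (e / (A + 1)).
have d0 : 0 < d by rewrite lt_min r0 divr_gt0.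
have dr : d <= r by rewrite ge_min lexx.
have de : d <= e / (A + 1) by rewrite ge_min lexx orbT.
exists (r - d); first by rewrite subr_ge0 dr gtrDl oppr_lt0.
rewrite opprB addrC subrK (le_lt_trans (ler_wpM2r A0 de))//.
by rewrite mulrAC ltr_pdivrMr// ltr_pM2l// ltrDl.
Qed.

Section boundary.
Context {R : realType} (m : nat) (hn : (2 <= m.+1)%N) (h : R) (w : set 'rV[R]_m).
Variable u : 'rV[R]_m.+1 -> R.
Local Notation Om := (cylinder hn h w).
Local Notation D := (open_cylinder h w).
Hypotheses (ow : open w) (bw : bounded_set w) (Cu : Ck_closure 3 Om u).
Hypothesis u0 : forall x : 'rV[R]_m.+1, 0 <= x ord0 ord0 <= h ->
  (closure w `\` interior w) (col' ord0 x) -> u x = 0.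

Let DE : Om° = D. Proof. exact: interior_cylinder. Qed.

Lemma cylinder_is_derive s (i : 'I_m.+1) x : (size s < 3)%N -> D x ->
  is_derive x (delta_mx ord0 i) (partials s u) (partials (i :: s) u x).
Proof. by rewrite -DE; exact: Ck_closure_is_derive. Qed.

Lemma cylinder_continuous s x : (size s <= 3)%N -> D x ->
  {for x, continuous (partials s u)}.
Proof. by rewrite -DE; exact: Ck_closure_continuous. Qed.

Lemma cylinder_bounded s : (size s <= 3)%N -> bounded_on D (partials s u).
Proof.
have [K OmK] := cylinder_coord_bounded hn h bw.
rewrite -DE => s3; apply: (Ck_closure_bounded Cu (K := K)) => // x Omx j.
by rewrite ltW// OmK.
Qed.

(** The exit point lies over the boundary of [w], where [u] vanishes; continuity of [u] on the
    closure makes it small just before the exit. *)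
Lemma lateral_exit (i : 'I_m.+1) x (s r : R) : i != ord0 -> 0 < r -> D x ->
  ~ D (x + (r * s) *: delta_mx ord0 i) ->
  (forall t, 0 <= t < r -> D (x + (t * s) *: delta_mx ord0 i)) ->
  forall e, 0 < e ->
    exists2 t, 0 <= t < r & `|u (x + (t * s) *: delta_mx ord0 i)| <= e.
Proof.
move=> i0 r0 Dx; set v := delta_mx _ _; set y := x + _ => nDy Dt e e0.
have yx (t : R) : y - (x + (t * s) *: v) = ((r - t) * s) *: v.
  by rewrite /y opprD addrACA subrr add0r -scalerBl -mulrBl.
have near_y d : 0 < d -> exists2 t, 0 <= t < r & `|y - (x + (t * s) *: v)| < d.
  move=> d0; have [|t tr td] := @near_below R r (`|s| * `|v|) d r0 _ d0.
    by rewrite mulr_ge0.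
  exists t => //; rewrite yx normrZ normrM -mulrA ger0_norm// subr_ge0.
  by case/andP: tr => _ /ltW.
have cDy : closure D y.
  move=> B /nbhs_ballP[d /= d0 dB]; have [t tr td] := near_y d d0.
  by exists (x + (t * s) *: v); split; [exact: Dt|apply: dB; rewrite -ball_normE].
(* A non-axial direction keeps the first coordinate, so only the lateral part of [y] can have left
   its range [w]. *)
have uy : u y = 0.
  apply: u0; first by rewrite line_coord0//; case: Dx => /andP[/ltW -> /ltW ->].
  split.
    move=> B nB; have [z [[_ wz] Bz]] := cDy _ (continuous_col' nB).
    by exists (col' ord0 z).
  move=> /interior_subset wy; apply: nDy; split => //.
  by rewrite line_coord0//; case: Dx.
have cOmy : closure Om y.
  by apply: closureS cDy => z; rewrite -DE; exact: interior_subset.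
have [_ cu _] := Cu; have [d d0 hd] := within_continuous_near cu cOmy e0.
have [t tr td] := near_y d d0; exists t => //.
have /hd/(_ td) : closure Om (x + (t * s) *: v).
  by apply: subset_closure; apply: interior_subset; rewrite DE; exact: Dt.
by rewrite uy sub0r normrN => /ltW.
Qed.

Lemma vanishing_u (i : 'I_m.+1) : i != ord0 -> vanishing D (delta_mx ord0 i) u.
Proof.
move=> i0; have [M hM] := @cylinder_bounded [:: i] isT.
exists M => x s Dx nDx.
apply: (@norm_le_exit R _ D (delta_mx ord0 i) u (partial i u)) => //.
- exact: open_open_cylinder.
- by move=> y Dy; exact: (@cylinder_is_derive [::]).
- by move=> r /andP[r0 _] nD Dt e e0; apply: lateral_exit nD Dt e e0.
Qed.

Lemma open_cylinder_line0 x (s : R) : D x -> 0 < x ord0 ord0 + s < h ->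
  D (x + s *: delta_mx ord0 ord0).
Proof. by move=> [_ wx] xs; split; rewrite ?line0_coord0// line0_col'. Qed.

(* Up to a second-order error, [partial ord0 u] is a difference quotient of u
   between two points lying on the same axial line, at the same distance to the
   lateral boundary along the i-th direction. *)
Lemma vanishing_partial0 (i : 'I_m.+1) : i != ord0 ->
  vanishing D (delta_mx ord0 i) (partial ord0 u).
Proof.
move=> i0; have [M hM] := @cylinder_bounded [:: i; ord0] isT.
have [M0 hM0] := @cylinder_bounded [:: ord0; ord0] isT.
have [N hN] := vanishing_u i0.
exists M => x s Dx nDx.
apply: (@norm_le_exit R _ D (delta_mx ord0 i) (partial ord0 u)
  (partial i (partial ord0 u))) => //.
- exact: open_open_cylinder.
- by move=> y Dy; exact: (@cylinder_is_derive [:: ord0]).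
move=> r /andP[r0 _] nDy Dt e e0.
set v := delta_mx ord0 i in nDy Dt *; set e1 := delta_mx ord0 ord0 : 'rV[R]_m.+1.
have [/andP[x0 xh] wx] := Dx.
have M00 : 0 <= M0 := le_trans (normr_ge0 _) (hM0 x Dx).
(* The axial displacement [d] is small enough to stay below [h], and small enough for the
   second-order error [M0 * d] to be at most [e / 2]. *)
pose d := Num.min ((h - x ord0 ord0) / 2) (e / (2 * (M0 + 1))).
have M1 : 0 < 2 * (M0 + 1) by rewrite mulr_gt0// ltr_wpDl.
have hx : 0 < (h - x ord0 ord0) / 2 by rewrite divr_gt0// subr_gt0.
have d0 : 0 < d by rewrite lt_min hx divr_gt0.
have dh : d <= (h - x ord0 ord0) / 2 by rewrite ge_min lexx.
have de : M0 * d <= e / 2.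
  have : d <= e / (2 * (M0 + 1)) by rewrite ge_min lexx orbT.
  rewrite ler_pdivlMr// => ?; rewrite ler_pdivlMr//; nra.
(* Once [d] is fixed, [t] is taken so close to [r] that [u] is at most [d * e / 4] at both ends of
   the axial segment; its difference quotient is then at most [e / 2]. *)
have [||t tr td] := @near_below R r (`|s| * `|N|) (d * e / 4) r0 _ _.
- by rewrite mulr_ge0.
- by rewrite divr_gt0 ?mulr_gt0.
have Dq := Dt t tr; set q := x + (t * s) *: v in Dq *; exists t => //.
have q0 : q ord0 ord0 = x ord0 ord0 by rewrite line_coord0.
have Dqd c : 0 <= c <= 1 -> D (q + (c * d) *: e1).
  move=> /andP[c0 c1]; apply: open_cylinder_line0 => //; rewrite q0.
  have cd : c * d <= d by rewrite ler_piMl// ltW.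
  have cd0 : 0 <= c * d by rewrite mulr_ge0// ltW.
  apply/andP; split; nra.
have bu c : 0 <= c <= 1 -> `|u (q + (c * d) *: e1)| <= d * e / 4.
  move=> c01; have Dc := Dqd c c01.
  apply: le_trans (hN _ ((r - t) * s) Dc _) _.
    (* The axial shift does not change the lateral part: a point of [D] here would put the lateral
       part of the exit point in [w]. *)
    move=> [_]; rewrite addrAC line0_col' /q -addrA -scalerDl -mulrDl [t + _]addrC subrK => wy.
    by apply: nDy; split => //; rewrite line_coord0//; case: Dx.
  have rt : 0 <= r - t by rewrite subr_ge0 ltW//; case/andP: tr.
  apply: le_trans (ltW td); rewrite mulrC normrM -mulrA ger0_norm//.
  by rewrite ler_wpM2l// ler_wpM2l// ler_norm.
have [c c01|c /andP[c0 c1] E1] :=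
    @mean_value_line _ _ u (partial ord0 u) q e1 d.
  by apply: (@cylinder_is_derive [::]) => //; exact: Dqd.
have [a a01|a /andP[a0 a1] E2] :=
    @mean_value_line _ _ (partial ord0 u) (partial ord0 (partial ord0 u)) q e1 (c * d).
  apply: (@cylinder_is_derive [:: ord0]) => //; rewrite mulrA; apply: Dqd.
  by case/andP: a01 => ? ?; rewrite mulr_ge0 ?(ltW c0)//= mulr_ile1// ltW.
have b2 : `|partial ord0 (partial ord0 u) (q + (a * (c * d)) *: e1)| <= M0.
  apply: (hM0); rewrite mulrA; apply: Dqd.
  by rewrite mulr_ge0 ?(ltW c0) ?(ltW a0)//= mulr_ile1// ltW.
have := bu 1; rewrite mul1r ler01 lexx => /(_ isT).
have := bu 0; rewrite mul0r scale0r addr0 lexx ler01 => /(_ isT).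
move: E1 E2 b2; set U1 := u _; set U2 := u _; set P := partial _ _ (_ + _).
set Q := partial _ _ q; set S := partial _ _ _.
move=> E1 E2; rewrite !ler_norml => /andP[S1 S2] /andP[u11 u12] /andP[u21 u22].
have P1 : - (e / 2) <= P by nra.
have P2 : P <= e / 2 by nra.
have /andP[cd0 cd] : 0 <= c * d <= d by apply/andP; split; nra.
have E3 : Q = P - c * d * S by rewrite -E2; ring.
have cdS : - (e / 2) <= c * d * S <= e / 2 by apply/andP; split; nra.
by case/andP: cdS => ? ?; rewrite E3; apply/andP; split; lra.
Qed.

End boundary.

(** * Symmetry of second derivatives *)

Section schwarz.
Context {R : realType} {V : normedModType R}.
Implicit Types (D : set V) (f g : V -> R) (x y v : V).

Lemma is_derive_shift f x v c (df : R) :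
  is_derive (x + c) v f df -> is_derive x v (fun y => f (y + c)) df.
Proof.
have E : (fun h : R => h^-1 *: (((fun y => f (y + c)) \o shift x) (h *: v) -
    f (x + c))) =
    (fun h : R => h^-1 *: ((f \o shift (x + c)) (h *: v) - f (x + c))).
  by apply/funext => h /=; rewrite addrA.
by move=> [dF <-]; split; [rewrite /derivable E|rewrite /derive E].
Qed.

(** The mean value theorem is used along [v1] for the increment of [f] over [d *: v2], then along
    [v2] for [f1]. *)
Lemma second_difference D f f1 f12 x v1 v2 (d : R) : 0 < d ->
  (forall a b : R, 0 <= a <= d -> 0 <= b <= d -> D (x + a *: v1 + b *: v2)) ->
  (forall y, D y -> is_derive y v1 f (f1 y)) ->
  (forall y, D y -> is_derive y v2 f1 (f12 y)) ->
  exists a b : R, [/\ 0 <= a <= d, 0 <= b <= d &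
    f (x + d *: v1 + d *: v2) - f (x + d *: v1) - (f (x + d *: v2) - f x) =
    d * (d * f12 (x + a *: v1 + b *: v2))].
Proof.
move=> d0 Dab d1 d2.
have dd : 0 <= d <= d by rewrite lexx ltW.
have Da (a : R) : 0 <= a <= d -> D (x + a *: v1).
  by move=> ad; have := Dab a 0 ad; rewrite scale0r addr0; apply; rewrite lexx ltW.
have rd (r : R) : 0 <= r <= 1 -> 0 <= r * d <= d.
  by move=> /andP[r0 r1]; rewrite mulr_ge0 ?(ltW d0)//= ler_piMl// ltW.
have [r /rd r1|r /andP[/ltW r0 /ltW r1] ->] := @mean_value_line _ _
    (fun y => f (y + d *: v2) - f y) (fun y => f1 (y + d *: v2) - f1 y) x v1 d.
  apply: is_deriveB; last exact/d1/Da.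
  by apply/is_derive_shift/d1/Dab.
have /rd rd1 : 0 <= r <= 1 by rewrite r0.
have [q /rd q1|q /andP[/ltW q0 /ltW q1] ->] := @mean_value_line _ _ f1 f12 (x + (r * d) *: v1) v2 d.
  exact/d2/Dab.
have /rd qd1 : 0 <= q <= 1 by rewrite q0.
by exists (r * d), (q * d).
Qed.

(** The second difference is symmetric in [v1] and [v2], so a value of [f12] near [x] equals a value
    of [f21] near [x]; continuity at [x] concludes. *)
Lemma mixed_derivatives_commute D f f1 f2 f12 f21 x v1 v2 : open D -> D x ->
  (forall y, D y -> is_derive y v1 f (f1 y)) ->
  (forall y, D y -> is_derive y v2 f (f2 y)) ->
  (forall y, D y -> is_derive y v2 f1 (f12 y)) ->
  (forall y, D y -> is_derive y v1 f2 (f21 y)) ->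
  {for x, continuous f12} -> {for x, continuous f21} -> f12 x = f21 x.
Proof.
move=> oD Dx d1 d2 d12 d21 c12 c21; apply/eqP; rewrite -subr_eq0 -normr_le0.
apply/ler_addgt0Pr => e e0; rewrite add0r.
have e2 : 0 < e / 2 by rewrite divr_gt0.
have nD : nbhs x D by exact: open_nbhs_nbhs.
have /cvgrPdist_lt/(_ _ e2) n12 := c12.
have /cvgrPdist_lt/(_ _ e2) n21 := c21.
have /nbhs_ballP[d' /= d'0 hd'] : nbhs x [set y |
    [/\ D y, `|f12 x - f12 y| < e / 2 & `|f21 x - f21 y| < e / 2]].
  by apply: filterS3 nD n12 n21 => y.
pose A := `|v1| + `|v2|; have A0 : 0 <= A by rewrite addr_ge0.
(* With this [d] the whole parallelogram stays in the ball of radius [d']. *)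
pose d := d' / (A + 1); have A1 : 0 < A + 1 by rewrite ltr_wpDl.
have d0 : 0 < d by rewrite divr_gt0.
have hd (a b : R) : 0 <= a <= d -> 0 <= b <= d -> [/\ D (x + a *: v1 + b *: v2),
    `|f12 x - f12 (x + a *: v1 + b *: v2)| < e / 2 &
    `|f21 x - f21 (x + a *: v1 + b *: v2)| < e / 2].
  move=> /andP[a0 ad] /andP[b0 bd]; suff /hd'[] : ball x d' (x + a *: v1 + b *: v2) by [].
  rewrite -ball_normE /ball_/= -addrA opprD addrA subrr sub0r normrN.
  rewrite (le_lt_trans (ler_normD _ _))// !normrZ !ger0_norm//.
  rewrite (@le_lt_trans _ _ (d * A))//; first by rewrite mulrDr lerD// ler_wpM2r.
  by rewrite /d mulrAC ltr_pdivrMr// ltr_pM2l// ltrDl.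
have [|a [b [ad bd E1]]] := @second_difference D f f1 f12 x v1 v2 d d0 _ d1 d12.
  by move=> a b ad bd; have [] := hd a b ad bd.
have [|a' [b' [ad' bd' E2]]] := @second_difference D f f2 f21 x v2 v1 d d0 _ d2 d21.
  by move=> a' b' ad' bd'; rewrite addrAC; have [] := hd b' a' bd' ad'.
have E : f12 (x + a *: v1 + b *: v2) = f21 (x + b' *: v1 + a' *: v2).
  have dn0 : d != 0 by rewrite gt_eqF.
  apply: (mulfI dn0); apply: (mulfI dn0); rewrite -E1 [x + b' *: v1 + _]addrAC -E2.
  rewrite [x + d *: v2 + d *: v1]addrAC.
  by rewrite !opprB addrACA [in RHS]addrACA; congr (_ + _); rewrite addrC.
have [_ h1 _] := hd a b ad bd; have [_ _ h2] := hd b' a' bd' ad'.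
rewrite E in h1; rewrite distrC in h2.
rewrite (le_trans (ler_distD (f21 (x + b' *: v1 + a' *: v2)) _ _))//.
by rewrite (splitr e) ltW// ltrD.
Qed.

End schwarz.

(** * Calculus of bounded functions differentiable along a direction *)

Section C1_bounded.
Context {R : realType} (n : nat) (D : set 'rV[R]_n) (v : 'rV[R]_n).
Implicit Types F G : 'rV[R]_n -> R.

(** What the integral theorem asks of [F] and its derivative [G] along [v], apart from the decay at
    the exit. Stability under sums and products yields measurability, bounds and derivatives of
    composite expressions all at once. *)
Definition C1_bounded F G : Prop :=
  [/\ measurable_fun D F, measurable_fun D G, bounded_on D F, bounded_on D G &
      forall x, D x -> is_derive x v F (G x)].

Lemma C1_bounded_eq F G G' : (forall x, D x -> G x = G' x) ->
  C1_bounded F G -> C1_bounded F G'.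
Proof.
move=> GG' [mF mG bF [M bG] dF]; split => //.
- by apply: eq_measurable_fun mG => x; rewrite inE => /GG'.
- by exists M => x Dx; rewrite -GG'// bG.
- by move=> x Dx; rewrite -GG'//; exact: dF.
Qed.

Lemma C1_bounded_cst (c : R) : C1_bounded (fun=> c) (fun=> 0).
Proof.
split; [exact: measurable_cst|exact: measurable_cst|exact: bounded_on_cst|
  exact: bounded_on_cst|by move=> x _; exact: is_derive_cst].
Qed.

Lemma C1_boundedD F1 G1 F2 G2 : C1_bounded F1 G1 -> C1_bounded F2 G2 ->
  C1_bounded (fun x => F1 x + F2 x) (fun x => G1 x + G2 x).
Proof.
move=> [? ? ? ? d1] [? ? ? ? d2]; split.
- exact: measurable_funD.
- exact: measurable_funD.
- exact: bounded_onD.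
- exact: bounded_onD.
- by move=> x Dx; exact: is_deriveD (d1 x Dx) (d2 x Dx).
Qed.

Lemma C1_boundedM F1 G1 F2 G2 : C1_bounded F1 G1 -> C1_bounded F2 G2 ->
  C1_bounded (fun x => F1 x * F2 x) (fun x => F1 x * G2 x + F2 x * G1 x).
Proof.
move=> [? ? ? ? d1] [? ? ? ? d2]; split.
- exact: measurable_funM.
- by apply: measurable_funD; exact: measurable_funM.
- exact: bounded_onM.
- by apply: bounded_onD; exact: bounded_onM.
- by move=> x Dx; exact: is_deriveM (d1 x Dx) (d2 x Dx).
Qed.

Lemma C1_boundedZ (c : R) F G : C1_bounded F G ->
  C1_bounded (fun x => c * F x) (fun x => c * G x).
Proof.
move=> FG; apply: C1_bounded_eq (C1_boundedM (C1_bounded_cst c) FG) => x _.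
by rewrite mulr0 addr0.
Qed.

Lemma C1_bounded_sum (I : Type) (r : seq I) (F G : I -> 'rV[R]_n -> R) :
  (forall i, C1_bounded (F i) (G i)) ->
  C1_bounded (fun x => \sum_(i <- r) F i x) (fun x => \sum_(i <- r) G i x).
Proof.
move=> FG; elim: r => [|i r IHr].
  under eq_fun do rewrite big_nil; under [X in C1_bounded _ X]eq_fun do rewrite big_nil.
  exact: C1_bounded_cst.
under eq_fun do rewrite big_cons; under [X in C1_bounded _ X]eq_fun do rewrite big_cons.
exact: C1_boundedD.
Qed.

Lemma C1_bounded_integral_eq0 F G : open D -> (lebesgue_rV n D < +oo)%E ->
  C1_bounded F G -> vanishing D v F -> (\int[lebesgue_rV n]_(x in D) (G x)%:E = 0)%E.
Proof.
move=> oD finD [mF mG [M1 bF] [M2 bG] dF] [M3 vF].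
pose M := `|M1| + (`|M2| + `|M3|).
have h1 : M1 <= M by rewrite (le_trans (ler_norm _))// lerDl addr_ge0.
have h2 : M2 <= M by rewrite (le_trans (ler_norm _))// /M addrCA lerDl addr_ge0.
have h3 : M3 <= M by rewrite (le_trans (ler_norm _))// /M addrA lerDr addr_ge0.
apply: (@integral_directional_derivative_eq0 _ n D v F G M) => //.
- by move=> x Dx; exact: le_trans (bF x Dx) h1.
- by move=> x Dx; exact: le_trans (bG x Dx) h2.
- by move=> x s Dx nD; rewrite (le_trans (vF x s Dx nD))// ler_wpM2r.
Qed.

End C1_bounded.

(** * Pointwise algebra: Young's inequality and the divergence identity *)

Lemma weighted_young {R : realFieldType} n (lam Lam h t u g q : R) (i0 : 'I_n)
    (S U : 'I_n -> R) :
  0 < lam -> 0 < h -> 0 <= t <= h -> (forall j, `|S j| <= Lam) ->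
  q = g - 6 * (h - 2 * t) / h ^+ 2 * (S i0 * (u * U i0))
    + 2 * (1 - 6 * (t * (h - t)) / h ^+ 2) * (U i0 * \sum_j S j * U j) ->
  lam * \sum_j U j ^+ 2 <= q ->
  lam / 2 * \sum_j U j ^+ 2 <=
    g + 6 * Lam / h * `|u * U i0| + n%:R * (2 * Lam ^+ 2 / lam) * U i0 ^+ 2.
Proof.
move=> lam0 h0 /andP[t0 th] SL -> ell.
pose y := 6 * (t * (h - t)) / h ^+ 2; pose z := 6 * (h - 2 * t) / h ^+ 2.
have hh : 0 < h ^+ 2 by rewrite exprn_gt0.
have y1 : `|1 - y| <= 1.
  have yE : y * h ^+ 2 = 6 * (t * (h - t)) by rewrite /y divfK// gt_eqF.
  have y0 : 0 <= y by apply: divr_ge0; [nra|exact: ltW].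
  have y2 : y <= 2.
    by rewrite /y ler_pdivrMr//; have := sqr_ge0 (2 * t - h); nra.
  by rewrite ler_norml; apply/andP; split; lra.
have z1 : `|z| <= 6 / h.
  have E : 6 / h * h ^+ 2 = 6 * h by field; rewrite gt_eqF.
  rewrite ler_norml /z; apply/andP; split.
    by rewrite ler_pdivlMr// mulNr E; lra.
  by rewrite ler_pdivrMr// E; lra.
have L0 : 0 <= Lam := le_trans (normr_ge0 _) (SL i0).
have b1 : - z * (S i0 * (u * U i0)) <= 6 * Lam / h * `|u * U i0|.
  have bS : `|S i0 * (u * U i0)| <= Lam * `|u * U i0| by rewrite normrM ler_wpM2r.
  apply: le_trans (ler_norm _) _; rewrite normrM normrN.
  have -> : 6 * Lam / h * `|u * U i0| = 6 / h * (Lam * `|u * U i0|) by ring.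
  exact: ler_pM.
(* Young's inequality from the square of [lam / 2 * U j - a * U i0]. Summed over [j], its first term
   uses up half of the ellipticity bound, and its second gives the factor [n%:R]. *)
have b2 j : 2 * (1 - y) * (U i0 * (S j * U j)) <=
    lam / 2 * U j ^+ 2 + 2 * Lam ^+ 2 / lam * U i0 ^+ 2.
  have : `|(1 - y) * S j| <= Lam by rewrite normrM -[leRHS]mul1r ler_pM.
  set a := (1 - y) * S j => aL.
  have aa : a ^+ 2 <= Lam ^+ 2 by rewrite -real_normK ?num_real// ler_pXn2r ?nnegrE.
  have -> : 2 * (1 - y) * (U i0 * (S j * U j)) = 2 * a * U i0 * U j by rewrite /a; ring.
  have sq := sqr_ge0 (lam / 2 * U j - a * U i0).
  rewrite -(ler_pM2l lam0) [leRHS]mulrDr; set c := 2 * Lam ^+ 2 / lam.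
  have -> : lam * (c * U i0 ^+ 2) = 2 * (Lam ^+ 2 * U i0 ^+ 2).
    by rewrite /c; field; rewrite gt_eqF.
  have aU : a ^+ 2 * U i0 ^+ 2 <= Lam ^+ 2 * U i0 ^+ 2 by rewrite ler_wpM2r// sqr_ge0.
  lra.
have b3 : 2 * (1 - y) * (U i0 * \sum_j S j * U j) <=
    lam / 2 * \sum_j U j ^+ 2 + n%:R * (2 * Lam ^+ 2 / lam) * U i0 ^+ 2.
  rewrite !mulr_sumr (le_trans (ler_sum _ (fun j _ => b2 j)))//.
  by rewrite big_split/= sumr_const card_ord -[X in _ + X <= _]mulr_natl mulrA.
rewrite -/y -/z in ell.
move: ell b1 b3; lra.
Qed.

Section divergence_identity.
Context {R : realFieldType} (n : nat) (i0 : 'I_n).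
Variables (S U2 : 'I_n -> 'I_n -> R) (U : 'I_n -> R) (u t h : R).
Hypotheses (h0 : h != 0) (symS : forall i j, S i j = S j i).
Hypothesis (symU2 : forall i j, U2 i j = U2 j i).
Hypothesis trace0 : \sum_i \sum_j S i j * U2 i j = 0.

Let N i := \sum_j S i j * U j.
Let dN i k := \sum_j S i j * U2 k j.
Let q := \sum_i U i * N i.
Let dq k := \sum_i (U i * dN i k + N i * U2 k i).
Let b := t * (h - t).
Let c := h - 2 * t.

(* The derivative of [energy_field] below along the i-th axis. *)
Definition field_divergence (i : 'I_n) : R :=
  b * (6 / h ^+ 2 * (u * dN i i + N i * U i)
       - 2 / h ^+ 2 * (c * (U i0 * dN i i + N i * U2 i i0)
                       - 2 * (i == i0)%:R * (U i0 * N i))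
       + (i == i0)%:R * (c * dq i - 2 * q) / h ^+ 2)
  + (i == i0)%:R * c * (6 / h ^+ 2 * (u * N i)
       - 2 / h ^+ 2 * (c * (U i0 * N i)) + (c * q) / h ^+ 2)
  - (i != i0)%:R * (6 / h ^+ 2 * S i0 i) * (c * (u * U i)).

(** As [c ^+ 2 = h ^+ 2 - 4 * b], the derivative [c ^+ 2 - 2 * b] of [b * c] in [t], divided by
    [h ^+ 2], is [1 - 6 * b / h ^+ 2]; the coefficients of [q] from the two multipliers thus add up
    to 1. The terms with a second derivative cancel by [trace0] and by [dq i0 = 2 * K]. *)
Lemma sum_field_divergence : \sum_i field_divergence i =
  q + 6 * c / h ^+ 2 * (S i0 i0 * (u * U i0))
    - 2 * (1 - 6 * b / h ^+ 2) * (U i0 * N i0).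
Proof.
pose K := \sum_i N i * U2 i i0.
(* [Z] is what the direction [i0] contributes beyond the expression common to all directions; its
   last term restores the product [u * U i0], which is not absorbed. *)
pose Z := c * (6 / h ^+ 2 * (u * N i0)
       - 2 / h ^+ 2 * (c * (U i0 * N i0)) + (c * q) / h ^+ 2)
  + b * (4 / h ^+ 2 * (U i0 * N i0) + (c * (2 * K) - 2 * q) / h ^+ 2)
  + 6 / h ^+ 2 * c * u * (S i0 i0 * U i0).
(* Symmetry of [S] and [U2] makes the two halves of the derivative of [q] equal. *)
have dqE : dq i0 = 2 * K.
  rewrite /dq big_split/=.
  have -> : \sum_i U i * dN i i0 = K.
    under eq_bigr do rewrite mulr_sumr.
    rewrite exchange_big/=; apply: eq_bigr => j _; rewrite mulr_suml.
    by apply: eq_bigr => i _; rewrite symS symU2 mulrCA mulrA.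
  have -> : \sum_i N i * U2 i0 i = K by apply: eq_bigr => i _; rewrite symU2.
  ring.
have E i : field_divergence i =
    6 * b / h ^+ 2 * u * dN i i + 6 * b / h ^+ 2 * (U i * N i)
    - 2 * b * c / h ^+ 2 * U i0 * dN i i - 2 * b * c / h ^+ 2 * (N i * U2 i i0)
    - 6 / h ^+ 2 * c * u * (S i0 i * U i) + (if i == i0 then Z else 0).
  rewrite /field_divergence; have [->|_] := eqVneq i i0.
    by rewrite dqE /Z/=; ring.
  by rewrite /=; ring.
under eq_bigr do rewrite E.
rewrite !big_split/= !sumrN -!mulr_sumr -big_mkcond big_pred1_eq.
rewrite trace0 -/q -/K -/(N i0) /Z.
by clear E dqE; rewrite /Z; clear Z; move: q K (N i0) => q' K' N0; rewrite /b /c; field.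
Qed.

End divergence_identity.

(** * The energy field of a solution *)

Lemma is_derive_coord {R : realType} n (x v : 'rV[R]_n) (i : 'I_n) :
  is_derive x v (fun y : 'rV[R]_n => y ord0 i) (v ord0 i).
Proof.
have E : (fun h : R => h^-1 *: (((fun y : 'rV[R]_n => y ord0 i) \o shift x) (h *: v) -
    x ord0 i)) @ 0^' --> v ord0 i.
  apply: cvg_near_cst; near=> h.
  rewrite /= !mxE addrK -[_ *: _]/(_ * _) mulrA mulVf ?mul1r//.
  by near: h; exact: nbhs_dnbhs_neq.
by split; [apply/cvg_ex; exists (v ord0 i)|exact: cvg_lim].
Unshelve. all: by end_near. Qed.

Section energy.
Context {R : realType} (m : nat) (hn : (2 <= m.+1)%N) (h : R) (w : set 'rV[R]_m).
Variables (u : 'rV[R]_m.+1 -> R) (A : 'M[R]_m.+1).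
Local Notation Om := (cylinder hn h w).
Local Notation D := (open_cylinder h w).
Hypotheses (ow : open w) (bw : bounded_set w) (h0 : 0 < h).
Hypothesis Cu : Ck_closure 3 Om u.
Hypothesis u0 : forall x : 'rV[R]_m.+1, 0 <= x ord0 ord0 <= h ->
  (closure w `\` interior w) (col' ord0 x) -> u x = 0.
Hypothesis Lu : forall x, D x -> constant_coeff_op A u x = 0.

Local Notation e i := (delta_mx ord0 i : 'rV[R]_m.+1).

Let oD : open D. Proof. exact: open_open_cylinder. Qed.

Lemma partial_comm i j x : D x -> partial i (partial j u) x = partial j (partial i u) x.
Proof.
move=> Dx.
apply: (@mixed_derivatives_commute _ _ D u (partial j u) (partial i u) _ _ x (e j) (e i)) => //.
- by move=> y Dy; exact: (cylinder_is_derive ow Cu (s := [::])).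
- by move=> y Dy; exact: (cylinder_is_derive ow Cu (s := [::])).
- by move=> y Dy; exact: (cylinder_is_derive ow Cu (s := [:: j])).
- by move=> y Dy; exact: (cylinder_is_derive ow Cu (s := [:: i])).
- exact: (cylinder_continuous ow Cu (s := [:: i; j])).
- exact: (cylinder_continuous ow Cu (s := [:: j; i])).
Qed.

Lemma C1_bounded_partials s k : (size s < 3)%N ->
  C1_bounded D (e k) (partials s u) (partials (k :: s) u).
Proof.
move=> s3; split.
- by apply: open_continuous_measurable_rV => // x; apply: (cylinder_continuous ow Cu); exact: ltnW.
- by apply: open_continuous_measurable_rV => // x; exact: (cylinder_continuous ow Cu).
- by apply: (cylinder_bounded ow bw Cu); exact: ltnW.
- exact: (cylinder_bounded ow bw Cu).
- by move=> x; exact: (cylinder_is_derive ow Cu).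
Qed.

(** The symmetric part of [A] has the same quadratic form and, second derivatives being symmetric,
    the same operator; the Rellich identity relies on its symmetry. *)
Definition sym_coeff i j : R := (A i j + A j i) / 2.

Let S := sym_coeff.
Let U i := partial i u.
Let U2 i j := partial i (partial j u).
Let N i x := \sum_j S i j * U j x.
Let q x := \sum_i U i x * N i x.
Let T (x : 'rV[R]_m.+1) := x ord0 ord0.
Let b x := T x * (h - T x).
Let c x := h - 2 * T x.

(* With weights [6 * b / h ^+ 2] (first multiplier) and [b * c / h ^+ 2] (second),
   the fluxes are [u * N i] and [U ord0 * N i]. The two terms carrying a boolean
   factor are those with a flux along a single axis: the Rellich term
   [q / 2] along the axis, and the term in [u ^+ 2] which absorbs
   the products [u * U i] with [i != ord0]. *)
Definition energy_field i x :=
  b x * (6 / h ^+ 2 * (u x * N i x) - 2 / h ^+ 2 * (c x * (U ord0 x * N i x))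
         + (i == ord0)%:R * (c x * q x) / h ^+ 2)
  - (i != ord0)%:R * (3 / h ^+ 2 * S ord0 i) * (c x * (u x * u x)).

Lemma C1_bounded_coord0 k : C1_bounded D (e k) T (fun=> (k == ord0)%:R).
Proof.
split.
- exact: measurable_funTS (measurable_rV_coord ord0).
- exact: measurable_cst.
- by exists h => x [/andP[x0 xh] _]; rewrite gtr0_norm// ltW.
- exact: bounded_on_cst.
- move=> x _; have := is_derive_coord x (e k) ord0.
  by rewrite mxE eqxx/= eq_sym.
Qed.

(** The field is assembled from [u], its first derivatives and the axial coordinate by the sum and
    product rules; [ring] then matches both the field and its derivative. *)
Lemma C1_bounded_energy_field i : C1_bounded D (e i) (energy_field i)
  (fun x => field_divergence ord0 S (fun j k => U2 j k x) (U ^~ x) (u x) (T x) h i).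
Proof.
have CT := C1_bounded_coord0 i.
have Cc := C1_boundedD (C1_bounded_cst D (e i) h) (C1_boundedZ (-2) CT).
have Cb := C1_boundedM CT (C1_boundedD (C1_bounded_cst D (e i) h) (C1_boundedZ (-1) CT)).
have Cu' : C1_bounded D (e i) u (U i) by exact: (@C1_bounded_partials [::] i isT).
have CU j : C1_bounded D (e i) (U j) (U2 i j) by exact: (@C1_bounded_partials [:: j] i isT).
have CN k := C1_bounded_sum (index_enum _) (fun j => C1_boundedZ (S k j) (CU j)).
have Cq := C1_bounded_sum (index_enum _) (fun k => C1_boundedM (CU k) (CN k)).
have CY := C1_boundedD (C1_boundedD (C1_boundedZ (6 / h ^+ 2) (C1_boundedM Cu' (CN i)))
  (C1_boundedZ (- (2 / h ^+ 2)) (C1_boundedM Cc (C1_boundedM (CU ord0) (CN i)))))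
  (C1_boundedZ ((i == ord0)%:R / h ^+ 2) (C1_boundedM Cc Cq)).
have CF := C1_boundedD (C1_boundedM Cb CY)
  (C1_boundedZ (- ((i != ord0)%:R * (3 / h ^+ 2 * S ord0 i)))
    (C1_boundedM Cc (C1_boundedM Cu' Cu'))).
have -> : energy_field i = fun x => (T x * (h + -1 * T x)) *
    (6 / h ^+ 2 * (u x * N i x) + - (2 / h ^+ 2) * ((h + -2 * T x) * (U ord0 x * N i x)) +
    (i == ord0)%:R / h ^+ 2 * ((h + -2 * T x) * q x)) +
    - ((i != ord0)%:R * (3 / h ^+ 2 * S ord0 i)) * ((h + -2 * T x) * (u x * u x)).
  by apply/funext => x; rewrite /energy_field /b /c; ring.
apply: C1_bounded_eq CF => x Dx.
rewrite /field_divergence.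
(* The sums are made opaque so that [ring] treats them as atoms. *)
set X1 := \sum_j S i j * U j x; set X2 := \sum_j S i j * U2 i j x.
set X3 := \sum_k U k x * _; set X4 := \sum_k (_ + _).
move: X1 X2 X3 X4 (u x) (U i x) (U ord0 x) (U2 i ord0 x) (S ord0 i) (T x).
by move=> *; case: (i == ord0); rewrite /=; ring.
Qed.

Let finD : (lebesgue_rV m.+1 D < +oo)%E.
Proof.
have [K OmK] := cylinder_coord_bounded hn h bw.
apply: (@bounded_rV_finite _ _ _ K); first exact: open_measurable_rV.
by move=> x [/andP[x0 xh] wx]; apply: OmK; rewrite cylinderE; split=> //; rewrite !ltW.
Qed.

Let bnd s : (size s < 3)%N -> bounded_on D (partials s u).
Proof. by move=> s3; apply: (cylinder_bounded ow bw Cu); exact: ltnW. Qed.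

Let bndN i : bounded_on D (N i).
Proof.
apply: bounded_on_sum => j; apply: bounded_onM; first exact: bounded_on_cst.
exact: (@bnd [:: j]).
Qed.

Let bndT : bounded_on D T.
Proof. by exists h => x [/andP[x0 xh] _]; rewrite gtr0_norm// ltW. Qed.

Let bndc : bounded_on D c.
Proof.
rewrite (_ : c = fun x => h + -2 * T x); last by apply/funext => x; rewrite /c; ring.
apply: bounded_onD; first exact: bounded_on_cst.
by apply: bounded_onM; [exact: bounded_on_cst|exact: bndT].
Qed.

(** An axial line leaves only through an end, so the exit distance is at least [T x] or [h - T x];
    the other factor of [b] is at most [h]. *)
Lemma vanishing_axial_weight : vanishing D (e ord0) b.
Proof.
exists h => x s Dx nD; have [/andP[x0 xh] wx] := Dx; rewrite /b /T.
have : ~ (0 < x ord0 ord0 + s < h).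
  by move=> xs; apply: nD; exact: open_cylinder_line0.
move/negP; rewrite negb_and -!leNgt => /orP s0.
have xx : 0 <= x ord0 ord0 * (h - x ord0 ord0) by rewrite mulr_ge0 ?subr_ge0 ?ltW.
rewrite ger0_norm//; case: s0 => s0.
  have sn : - s <= `|s| by rewrite -normrN ler_norm.
  nra.
have sn : s <= `|s| by exact: ler_norm.
nra.
Qed.

Lemma vanishing_energy_field i : vanishing D (e i) (energy_field i).
Proof.
have [->|i0] := eqVneq i ord0.
  rewrite (_ : energy_field ord0 = fun x => b x *
    (6 / h ^+ 2 * (u x * N ord0 x) + - (2 / h ^+ 2) * (c x * (U ord0 x * N ord0 x)) +
      h ^- 2 * (c x * q x))); last first.
    by apply/funext => x; rewrite /energy_field eqxx/=; ring.
  apply: vanishingM; first exact: vanishing_axial_weight.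
  have bu : bounded_on D u by exact: (@bnd [::]).
  have bU j : bounded_on D (U j) by exact: (@bnd [:: j]).
  apply: bounded_onD; first apply: bounded_onD.
  - by apply: bounded_onM; [exact: bounded_on_cst|exact: bounded_onM].
  - apply: bounded_onM; first exact: bounded_on_cst.
    by apply: bounded_onM => //; exact: bounded_onM.
  - apply: bounded_onM; first exact: bounded_on_cst.
    apply: bounded_onM => //; apply: bounded_on_sum => j.
    exact: bounded_onM.
(* Off the axis every term of the flux has [u] or [U ord0] as a factor, and both decay at the
   lateral boundary. *)
rewrite (_ : energy_field i = fun x => u x * (b x * (6 / h ^+ 2 * N i x) +
    - (3 / h ^+ 2 * S ord0 i) * (c x * u x)) +
    U ord0 x * (- (2 / h ^+ 2) * (b x * (c x * N i x)))); last first.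
  by apply/funext => x; rewrite /energy_field i0 (negbTE i0)/=; ring.
have bu : bounded_on D u by exact: (@bnd [::]).
have bb : bounded_on D b.
  rewrite (_ : b = fun x => T x * (h + -1 * T x)); last by apply/funext => x; rewrite /b; ring.
  apply: bounded_onM => //; apply: bounded_onD; first exact: bounded_on_cst.
  by apply: bounded_onM => //; exact: bounded_on_cst.
apply: vanishingD; apply: vanishingM.
- exact: (vanishing_u ow bw Cu u0).
- apply: bounded_onD; apply: bounded_onM => //.
  + by apply: bounded_onM => //; exact: bounded_on_cst.
  + exact: bounded_on_cst.
  + exact: bounded_onM.
- exact: (vanishing_partial0 ow bw Cu u0).
- apply: bounded_onM; first exact: bounded_on_cst.
  by apply: bounded_onM => //; exact: bounded_onM.
Qed.

(** The trace condition of the algebraic identity is the equation itself, written with the symmetric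
    part of [A]. *)
Lemma sum_energy_divergence x : D x ->
  \sum_i field_divergence ord0 S (fun j k => U2 j k x) (U ^~ x) (u x) (T x) h i =
  q x + 6 * c x / h ^+ 2 * (S ord0 ord0 * (u x * U ord0 x))
    - 2 * (1 - 6 * b x / h ^+ 2) * (U ord0 x * N ord0 x).
Proof.
move=> Dx; have hn0 : h != 0 by rewrite gt_eqF.
have symS i j : S i j = S j i by rewrite /S /sym_coeff addrC.
have symU2 i j : U2 i j x = U2 j i x by exact: partial_comm.
suff tr : \sum_i \sum_j S i j * U2 i j x = 0.
  exact: (sum_field_divergence ord0 (U ^~ x) (u x) (T x) hn0 symS symU2 tr).
transitivity (constant_coeff_op A u x); last exact: Lu.
have E : \sum_i \sum_j A j i * U2 i j x = \sum_i \sum_j A i j * U2 i j x.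
  rewrite exchange_big/=; apply: eq_bigr => i _; apply: eq_bigr => j _.
  by rewrite symU2.
transitivity ((\sum_i \sum_j A i j * U2 i j x + \sum_i \sum_j A j i * U2 i j x) / 2).
  rewrite -big_split/= mulr_suml; apply: eq_bigr => i _.
  rewrite -big_split/= mulr_suml; apply: eq_bigr => j _.
  by rewrite /S /sym_coeff; ring.
rewrite E -[constant_coeff_op A u x]/(\sum_i \sum_j A i j * U2 i j x).
by move: (\sum_i _) => X; field.
Qed.

Variables (lam Lam : R).
Hypotheses (lam0 : 0 < lam).
Hypothesis elliptic : forall xi : 'rV[R]_m.+1,
  lam * (\sum_i xi ord0 i ^+ 2) <= \sum_i \sum_j A i j * xi ord0 i * xi ord0 j.
Hypothesis bounded_coeff : forall j, \sum_i `|A i j| <= Lam.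

Lemma sym_coeff_le i j : `|S i j| <= Lam.
Proof.
have AL k l : `|A k l| <= Lam.
  rewrite (le_trans _ (bounded_coeff l))// (bigD1 k)//= lerDl.
  by apply: sumr_ge0.
rewrite /S /sym_coeff normrM [X in _ * X]ger0_norm ?invr_ge0// ler_pdivrMr//.
by rewrite (le_trans (ler_normD _ _))// mulr_natr mulr2n lerD.
Qed.

(** The divergence takes the place of [g] in [weighted_young], and ellipticity is applied to the
    gradient of [u] at [x]. *)
Lemma energy_pointwise x : D x ->
  lam / 2 * \sum_i U i x ^+ 2 <=
    \sum_i field_divergence ord0 S (fun j k => U2 j k x) (U ^~ x) (u x) (T x) h i
    + 6 * Lam / h * `|u x * U ord0 x| + m.+1%:R * (2 * Lam ^+ 2 / lam) * U ord0 x ^+ 2.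
Proof.
move=> Dx; have [/andP[x0 xh] _] := Dx.
apply: (@weighted_young _ _ lam Lam h (T x) (u x) _ (q x) ord0 (S ord0)) => //.
- by rewrite !ltW.
- by move=> j; exact: sym_coeff_le.
- by rewrite sum_energy_divergence// /c /b /N; ring.
have := elliptic (\row_i U i x).
have -> : \sum_i (\row_j U j x) ord0 i ^+ 2 = \sum_i U i x ^+ 2.
  by apply: eq_bigr => i _; rewrite mxE.
move=> /le_trans; apply.
suff -> : \sum_i \sum_j A i j * (\row_j U j x) ord0 i * (\row_j U j x) ord0 j = q x by [].
transitivity ((\sum_i \sum_j A i j * U i x * U j x +
   \sum_i \sum_j A j i * U i x * U j x) / 2).
  have <- : \sum_i \sum_j A i j * U i x * U j x = \sum_i \sum_j A j i * U i x * U j x.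
    rewrite exchange_big/=; apply: eq_bigr => i _; apply: eq_bigr => j _.
    by rewrite mulrAC.
  transitivity (\sum_i \sum_j A i j * U i x * U j x).
    by apply: eq_bigr => i _; apply: eq_bigr => j _; rewrite !mxE.
  by move: (\sum_i _) => X; field.
rewrite -big_split/= mulr_suml; apply: eq_bigr => i _.
rewrite -big_split/= mulr_suml mulr_sumr; apply: eq_bigr => j _.
by rewrite /S /sym_coeff; ring.
Qed.

End energy.

(** * Integrated estimate on the open cylinder *)

Lemma energy_integral {R : realType} (m : nat) (hn : (2 <= m.+1)%N) (h : R)
    (w : set 'rV[R]_m) (u : 'rV[R]_m.+1 -> R) (A : 'M[R]_m.+1) (lam Lam C : R) :
  let Om := cylinder hn h w in let D := open_cylinder h w in
  open w -> bounded_set w -> 0 < h -> Ck_closure 3 Om u ->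
  (forall x : 'rV[R]_m.+1, 0 <= x ord0 ord0 <= h ->
    (closure w `\` interior w) (col' ord0 x) -> u x = 0) ->
  (forall x, D x -> constant_coeff_op A u x = 0) -> 0 < lam ->
  (forall xi : 'rV[R]_m.+1, lam * (\sum_i xi ord0 i ^+ 2) <=
    \sum_i \sum_j A i j * xi ord0 i * xi ord0 j) ->
  (forall j, \sum_i `|A i j| <= Lam) ->
  12 * Lam / lam <= C -> 4 * m.+1%:R * Lam ^+ 2 / lam ^+ 2 <= C ->
  (\int[lebesgue_rV m.+1]_(x in D) (\sum_i partial i u x ^+ 2)%:E <=
   (C / h)%:E * \int[lebesgue_rV m.+1]_(x in D) `|u x * partial ord0 u x|%:E +
   C%:E * \int[lebesgue_rV m.+1]_(x in D) (partial ord0 u x ^+ 2)%:E)%E.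
Proof.
move=> Om D ow bw h0 Cu u0 Lu lam0 ell bA C1 C2.
have oD : open D by exact: open_open_cylinder.
have mD : measurable D by exact: open_measurable_rV.
have finD : (lebesgue_rV m.+1 D < +oo)%E.
  have [K OmK] := cylinder_coord_bounded hn h bw.
  apply: (@bounded_rV_finite _ _ _ K) => // x [/andP[x0 xh] wx]; apply: OmK.
  by rewrite cylinderE; split=> //; rewrite !ltW.
pose G i x := field_divergence ord0 (sym_coeff A)
  (fun j k => partial j (partial k u) x) (fun j => partial j u x) (u x) (x ord0 ord0) h i.
have CG i := C1_bounded_energy_field A ow bw Cu i.
have iG i : (lebesgue_rV m.+1).-integrable D (EFin \o G i).
  by have [_ mG _ [M bG] _] := CG i; exact: bounded_integrable bG.
have G0 i : (\int[lebesgue_rV m.+1]_(x in D) (G i x)%:E = 0)%E.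
  apply: C1_bounded_integral_eq0 (CG i) _ => //.
  exact: (vanishing_energy_field A ow bw Cu u0).
have ibm f : measurable_fun D f -> bounded_on D f ->
    (lebesgue_rV m.+1).-integrable D (EFin \o f).
  by move=> mf [M bf]; exact: bounded_integrable bf.
have [mu mu1 bu bu1 _] : C1_bounded D (delta_mx ord0 ord0) u (partial ord0 u).
  exact: (C1_bounded_partials ow bw Cu (s := [::]) ord0).
have mU i : measurable_fun D (partial i u).
  by have [] := C1_bounded_partials ow bw Cu (s := [:: i]) ord0 isT.
have bU i : bounded_on D (partial i u).
  by have [] := C1_bounded_partials ow bw Cu (s := [:: i]) ord0 isT.
have i1 : (lebesgue_rV m.+1).-integrable D (EFin \o (fun x => \sum_i partial i u x ^+ 2)).
  apply: ibm.
    apply: (@measurable_sum _ _ _ _ _ _ (fun i x => partial i u x ^+ 2)) => i.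
    exact: (measurable_funX 2 (mU i)).
  apply: (@bounded_on_sum _ _ _ _ _ (fun i x => partial i u x ^+ 2)) => i.
  exact: (bounded_onM (bU i) (bU i)).
have i2 : (lebesgue_rV m.+1).-integrable D (EFin \o (fun x => `|u x * partial ord0 u x|)).
  apply: ibm.
    by apply: measurableT_comp => //; exact: measurable_funM.
  by have [M bM] := bounded_onM bu bu1; exists M => x Dx; rewrite normr_id bM.
have i3 : (lebesgue_rV m.+1).-integrable D (EFin \o (fun x => partial ord0 u x ^+ 2)).
  by apply: ibm; [exact: (measurable_funX 2 mu1)|exact: (bounded_onM bu1 bu1)].
have iS := integrable_sum mD (index_enum _) (P := xpredT) (fun i _ => iG i).
have Gint : (\int[lebesgue_rV m.+1]_(x in D) (\sum_i (EFin \o G i) x) = 0)%E.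
  by rewrite (integral_sum mD iG); apply: big1 => i _; exact: G0.
have iS2 := integrableZl mD (2 / lam) iS.
have iR2 := integrableZl mD (C / h) i2.
have iR3 := integrableZl mD C i3.
(* The pointwise inequality is multiplied by [2 / lam], which produces the two quantities bounded by
   [C]. The divergence stays under the integral, where it contributes 0. *)
apply: (@le_trans _ _ (\int[lebesgue_rV m.+1]_(x in D)
  ((2 / lam)%:E * (\sum_i (EFin \o G i) x) + ((C / h)%:E * `|u x * partial ord0 u x|%:E +
    C%:E * (partial ord0 u x ^+ 2)%:E)))%E).
  apply: le_integral => //; first by apply: integrableD => //; exact: integrableD.
  move=> x; rewrite inE => Dx.
  have := energy_pointwise ow h0 Cu Lu lam0 ell bA Dx.
  rewrite sumEFin -!EFinM -!EFinD lee_fin -/(G _ x).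
  set X := \sum_i _ ^+ 2; set Y := \sum_i G i x; set a := `|u x * _|; set d := partial ord0 u x ^+ 2.
  move=> XY; have a0 : 0 <= a by exact: normr_ge0.
  have d0 : 0 <= d by exact: sqr_ge0.
  have -> : X = 2 / lam * (lam / 2 * X) by field; rewrite gt_eqF.
  apply: (@le_trans _ _ (2 / lam * (Y + 6 * Lam / h * a +
      m.+1%:R * (2 * Lam ^+ 2 / lam) * d))).
    by rewrite ler_wpM2l// divr_ge0// ltW.
  have -> : 2 / lam * (Y + 6 * Lam / h * a + m.+1%:R * (2 * Lam ^+ 2 / lam) * d) =
      2 / lam * Y + (12 * Lam / lam / h * a + 4 * m.+1%:R * Lam ^+ 2 / lam ^+ 2 * d).
    by field; rewrite !gt_eqF.
  rewrite lerD2l; apply: lerD; rewrite ler_wpM2r//.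
  by rewrite ler_wpM2r// invr_ge0 ltW.
rewrite integralD//; last exact: integrableD.
rewrite integralD// !integralZl// Gint mule0 add0e.
by [].
Qed.

(** * Passage to the closed cylinder *)

Lemma within_continuous_measurable_rV {R : realType} n (B : set 'rV[R]_n)
    (f : 'rV[R]_n -> R) :
  measurable B -> {within B, continuous f} -> measurable_fun B f.
Proof.
move=> mB cf; apply: (measurability _ (RGenOpens.measurableE R)) => //.
move=> _ [_ [a [b ->] <-]].
have oab : open (`]a, b[%classic : set R) by exact: itv_open.
have /open_subspaceP[V oV VB] := (continuousP _).1 cf _ oab.
rewrite setIC -VB; apply: measurableI => //; exact: open_measurable_rV.
Qed.

(** A point is moved along the axis by a small fraction of its way to the middle section. Limits
    from the interior are therefore meaningful on the end faces too. *)
Lemma cylinder_sub_closure {R : realType} m (hn : (2 <= m.+1)%N) (h : R)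
    (w : set 'rV[R]_m) : open w -> 0 < h ->
  cylinder hn h w `<=` closure (cylinder hn h w)°.
Proof.
move=> ow h0; rewrite interior_cylinder// cylinderE => x [/andP[x0 xh] wx] B.
move=> /nbhs_ballP[e /= e0 eB].
pose t := Num.min 1 (e / h); pose s := t / 2 * (h / 2 - x ord0 ord0).
have t0 : 0 < t by rewrite lt_min ltr01 divr_gt0.
have t1 : t <= 1 by rewrite ge_min lexx.
have te : t * h <= e by rewrite -ler_pdivlMr// ge_min lexx orbT.
exists (x + s *: delta_mx ord0 ord0); split.
  split; last by rewrite line0_col'.
  by rewrite line0_coord0 /s; apply/andP; split; nra.
apply: eB; split=> // i j; rewrite /ball/= !mxE opprD addrA subrr sub0r normrN normrM.
have se : `|s| < e by rewrite /s ltr_norml; apply/andP; split; nra.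
by rewrite (le_lt_trans _ se)// ler_piMr//; case: (_ && _); rewrite ?normr1 ?normr0.
Qed.

(** The pointwise limits defining [partial_bar] all come from one function continuous on the
    closure, which gives measurability on [Om]. *)
Lemma partial_bar_extension {R : realType} n (Om : set 'rV[R]_n) (u : 'rV[R]_n -> R)
    (k : nat) (i : 'I_n) : (0 < k)%N -> Ck_closure k Om u -> Om `<=` closure Om° ->
  exists2 g : 'rV[R]_n -> R, {within closure Om, continuous g} &
    forall x, Om x -> partial_bar Om i u x = g x.
Proof.
move=> k0 [_ _ /(_ [:: i] k0) [g [cg gu]]] Omcl; exists g => // x Omx.
have PF : ProperFilter (within Om° (nbhs x)) by apply: within_nbhs_proper; exact: Omcl.
have gx := (subspace_continuousP _ _).1 cg x (subset_closure Omx).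
apply: cvg_lim => // U Ug.
have nU : \forall z \near x, closure Om z -> U (g z) := gx U Ug.
have : \forall z \near x, Om° z -> U (partial i u z).
  apply: filterS nU => z zU Oz; rewrite -[partial i u z]/(partials [:: i] u z) -gu//.
  by apply: zU; apply: subset_closure; exact: interior_subset.
by [].
Qed.

(** * Squares and products of L2 norms *)

Section L2norm_theory.
Context {R : realType} (n : nat).
Local Open Scope ereal_scope.

Lemma L2norm_sqr (Om : set 'rV[R]_n) (f : 'rV[R]_n -> R) : measurable Om ->
  L2norm Om f ^+ 2 = \int[lebesgue_rV n]_(x in Om) (f x ^+ 2)%:E.
Proof.
move=> mOm.
have I0 : 0 <= \int[lebesgue_rV n]_x `|((EFin \o f) \_ Om) x| `^ 2.
  by apply: integral_ge0 => x _; exact: poweR_ge0.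
rewrite /L2norm unlock poweR12_sqrt// sqr_sqrte// [RHS]integral_mkcond.
apply: eq_integral => x _; rewrite !patchE; case: ifPn => _ /=.
  by rewrite powR_mulrn// real_normK// num_real.
by rewrite normr0 powR0.
Qed.

(** Hoelder's inequality with both exponents equal to 2, applied to the functions extended by
    zero. *)
Lemma L2norm_cauchy_schwarz (Om : set 'rV[R]_n) (f g : 'rV[R]_n -> R) :
  measurable Om -> measurable_fun Om f -> measurable_fun Om g ->
  \int[lebesgue_rV n]_(x in Om) `|f x * g x|%:E <= L2norm Om f * L2norm Om g.
Proof.
move=> mOm mf mg.
have mf' := (measurable_restrictT f mOm).1 mf.
have mg' := (measurable_restrictT g mOm).1 mg.
have two_gt0 : (0 < 2 :> R)%R by [].
have two2 : (2^-1 + 2^-1 = 1 :> R)%R by rewrite -[X in (X + _)%R]div1r -[X in (_ + X)%R]div1r -splitr.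
have := @hoelder _ _ _ (lebesgue_rV n) _ _ 2 2 mf' mg' two_gt0 two_gt0 two2.
rewrite Lnorm1 /L2norm !restrict_EFin; apply: le_trans.
rewrite le_eqVlt; apply/orP; left; apply/eqP.
rewrite [LHS]integral_mkcond; apply: eq_integral => x _ /=.
by rewrite !patchE; case: ifPn => _ //; rewrite mul0r normr0.
Qed.

End L2norm_theory.

(** * The estimate in terms of norms *)

Lemma integral_cylinder_interior {R : realType} m (hn : (2 <= m.+1)%N) (h : R)
    (w : set 'rV[R]_m) (f : 'rV[R]_m.+1 -> R) : open w ->
  measurable_fun (cylinder hn h w) f -> (forall x, 0 <= f x) ->
  (\int[lebesgue_rV m.+1]_(x in cylinder hn h w) (f x)%:E =
   \int[lebesgue_rV m.+1]_(x in open_cylinder h w) (f x)%:E)%E.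
Proof.
move=> ow mf f0; have [N [mN N0 <-]] := cylinder_boundary_null hn h w.
apply: ge0_negligible_integral => //; first exact: measurable_cylinder.
- exact/measurable_EFinP.
- by move=> x _; rewrite lee_fin.
Qed.

Unset Implicit Arguments.

Theorem lemma3p1 (R : realType) (n : nat) (hn : (2 <= n)%N) (lam Lam : R)
    (lam_gt0 : 0 < lam) (Lam_gt0 : 0 < Lam) :
  exists C : R,
  forall (w : set 'rV[R]_n.-1) (h : R) (A : 'M[R]_n) (u : 'rV[R]_n -> R),
    lipschitz_domain w -> bounded_set w -> 0 < h ->
    (forall xi : 'rV[R]_n,
      lam * (\sum_(i < n) xi ord0 i ^+ 2) <=
      \sum_(i < n) \sum_(j < n) A i j * xi ord0 i * xi ord0 j) ->
    (forall j : 'I_n, \sum_(i < n) `|A i j| <= Lam) ->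
    let Om := cylinder hn h w in
    Ck_closure 3 Om u ->
    (forall x, Om° x -> constant_coeff_op A u x = 0) ->
    (forall x : 'rV[R]_n, 0 <= x ord0 (coord1 hn) <= h ->
      (closure w `\` interior w) (col' (coord1 hn) x) -> u x = 0) ->
    let u_x1 := partial_bar Om (coord1 hn) u in
    ((L2norm Om (euclidean_grad Om u)) ^+ 2 <=
      (C / h)%:E * L2norm Om u * L2norm Om u_x1 +
      C%:E * (L2norm Om u_x1) ^+ 2)%E.
Proof.
(* [C] is the sum of the two nonnegative constants required by [energy_integral], hence at least
   each of them. *)
case: n hn => [//|m] hn; pose C := 12 * Lam / lam + 4 * m.+1%:R * Lam ^+ 2 / lam ^+ 2.
exists C => w h A u [_ ow _ _] bw h0 ell bA Om Cu Lu u0.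
have -> : coord1 hn = ord0 by exact: val_inj.
have {}u0 : forall x : 'rV[R]_m.+1, 0 <= x ord0 ord0 <= h ->
    (closure w `\` interior w) (col' ord0 x) -> u x = 0.
  by move: u0; rewrite (_ : coord1 hn = ord0)//; exact: val_inj.
cbv zeta; set u_x1 := partial_bar Om ord0 u; pose D := open_cylinder h w.
have DE : Om° = D by exact: interior_cylinder.
have mOm : measurable Om by exact: measurable_cylinder.
have Omcl : Om `<=` closure Om° by exact: cylinder_sub_closure.
have mcl (f : 'rV[R]_m.+1 -> R) : {within closure Om, continuous f} -> measurable_fun Om f.
  move=> cf; have cf' : {within Om, continuous f}.
    by apply: continuous_subspaceW cf; exact: subset_closure.
  exact: within_continuous_measurable_rV.
have mu : measurable_fun Om u by case: Cu => _ cu _; exact: mcl.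
have mpb i : measurable_fun Om (partial_bar Om i u).
  have [g cg gE] := partial_bar_extension i (isT : (0 < 3)%N) Cu Omcl.
  by apply: (eq_measurable_fun g) (mcl g cg) => x; rewrite inE => /gE.
have pbE i x : D x -> partial_bar Om i u x = partial i u x.
  by rewrite -DE; exact: (partial_bar_interior Cu).
have C0 : 0 <= 12 * Lam / lam by rewrite divr_ge0 ?ltW// mulr_gt0.
have C1 : 0 <= 4 * m.+1%:R * Lam ^+ 2 / lam ^+ 2.
  by rewrite divr_ge0 ?sqr_ge0// mulr_ge0 ?sqr_ge0.
have main := energy_integral ow bw h0 Cu u0 _ lam_gt0 ell bA
  (_ : 12 * Lam / lam <= C) (_ : 4 * m.+1%:R * Lam ^+ 2 / lam ^+ 2 <= C).
(* The norms involve the extended derivatives on the closed cylinder; these are the derivatives of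
   [u] in the interior, and the end faces are negligible. *)
have grad : (L2norm Om (euclidean_grad Om u) ^+ 2 =
    \int[lebesgue_rV m.+1]_(x in D) (\sum_i partial i u x ^+ 2)%:E)%E.
  rewrite L2norm_sqr//.
  transitivity (\int[lebesgue_rV m.+1]_(x in Om) (\sum_i partial_bar Om i u x ^+ 2)%:E)%E.
    apply: eq_integral => x _; rewrite /euclidean_grad sqr_sqrtr//.
    by apply: sumr_ge0 => i _; exact: sqr_ge0.
  rewrite integral_cylinder_interior//.
  - apply: eq_integral => x; rewrite inE => Dx; congr EFin.
    by apply: eq_bigr => i _; rewrite pbE.
  - apply: (@measurable_sum _ _ _ _ _ _ (fun i x => partial_bar Om i u x ^+ 2)) => i.
    exact: (measurable_funX 2 (mpb i)).
  - by move=> x; apply: sumr_ge0 => i _; exact: sqr_ge0.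
have axial : (L2norm Om u_x1 ^+ 2 =
    \int[lebesgue_rV m.+1]_(x in D) (partial ord0 u x ^+ 2)%:E)%E.
  rewrite L2norm_sqr// integral_cylinder_interior//.
  - by apply: eq_integral => x; rewrite inE => Dx; rewrite /u_x1 pbE.
  - exact: (measurable_funX 2 (mpb ord0)).
  - by move=> x; exact: sqr_ge0.
have cross : (\int[lebesgue_rV m.+1]_(x in D) `|u x * partial ord0 u x|%:E <=
    L2norm Om u * L2norm Om u_x1)%E.
  apply: le_trans (L2norm_cauchy_schwarz mOm mu (mpb ord0)).
  rewrite integral_cylinder_interior//.
  - rewrite le_eqVlt; apply/orP; left; apply/eqP.
    by apply: eq_integral => x; rewrite inE => Dx; rewrite pbE.
  - by apply: measurableT_comp => //; exact: measurable_funM mu (mpb ord0).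
rewrite grad axial; apply: le_trans (main _ _ _) _.
- by move=> x Dx; apply: Lu; rewrite DE.
- by rewrite lerDl.
- by rewrite lerDr.
have Ch : 0 <= C / h by rewrite divr_ge0 ?addr_ge0 ?(ltW h0).
by rewrite leeD2r// -muleA lee_wpmul2l.
Qed.
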